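(* Let $W$ and $W'$ be Coxeter groups with $\widehat W\cong\widehat{W'}$. Then $W$ has Serre's property $\mathsf{FA}$ if and only if $W'$ has property $\mathsf{FA}$.
   Context: A group has Serre's property $\mathsf{FA}$ if every action of it on a simplicial tree without edge inversions has a global fixed point. Coxeter groups are $W_\Gamma=\langle V(\Gamma)\mid v^2,\ (vw)^{m(\{v,w\})}\text{ for }\{v,w\}\in E(\Gamma)\rangle$ for a finite simplicial graph $\Gamma$ with labels $m\colon E(\Gamma)\to\mathbb{N}_{\ge 2}$; $\widehat{G}$ denotes profinite completion. *)

(* Defs.v *)
From Stdlib Require Import List Arith.
Import ListNotations.
Set Implicit Arguments.
Unset Strict Implicit.

Record Group := {
  gcar :> Type;
  gmul : gcar -> gcar -> gcar;
  ginv : gcar -> gcar;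
  gone : gcar;
  gmulA : forall x y z, gmul x (gmul y z) = gmul (gmul x y) z;
  gmul1x : forall x, gmul gone x = x;
  gmulx1 : forall x, gmul x gone = x;
  gmulVx : forall x, gmul (ginv x) x = gone;
  gmulxV : forall x, gmul x (ginv x) = gone
}.
Arguments gmul {g} _ _.
Arguments ginv {g} _.
Arguments gone {g}.

Fixpoint gpow (G : Group) (x : G) (n : nat) : G :=
  match n with 0 => gone | S k => gmul x (gpow x k) end.

Definition is_hom (G H : Group) (f : G -> H) : Prop :=
  forall x y, f (gmul x y) = gmul (f x) (f y).

Record CoxGraph := {
  cV : Type;
  cV_finite : exists l : list cV, forall v, In v l;
  cadj : cV -> cV -> Prop;
  cadj_sym : forall u v, cadj u v -> cadj v u;
  cadj_irrefl : forall v, ~ cadj v v;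
  cm : cV -> cV -> nat;
  cm_sym : forall u v, cm u v = cm v u;
  cm_ge2 : forall u v, cadj u v -> 2 <= cm u v
}.

Definition coxeter_relations (Gam : CoxGraph) (H : Group) (t : cV Gam -> H) : Prop :=
  (forall v, gmul (t v) (t v) = gone) /\
  (forall u v, cadj u v -> gpow (gmul (t u) (t v)) (cm u v) = gone).

(** [W] together with [s] is (a model of) the group presented by
    < V | v^2, (vw)^m(v,w) >, expressed by the universal property
    of the presentation. *)
Definition IsCoxeterPresentation (Gam : CoxGraph) (W : Group) (s : cV Gam -> W) : Prop :=
  coxeter_relations s /\
  forall (H : Group) (t : cV Gam -> H), coxeter_relations t ->
    exists f : W -> H, is_hom f /\ (forall v, f (s v) = t v) /\
      forall f' : W -> H, is_hom f' -> (forall v, f' (s v) = t v) -> forall x, f' x = f x.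

Definition IsCoxeterGroup (W : Group) : Prop :=
  exists (Gam : CoxGraph) (s : cV Gam -> W), IsCoxeterPresentation s.

Record FinIdxNormal (G : Group) := {
  fN : G -> Prop;
  fN_one : fN gone;
  fN_mul : forall x y, fN x -> fN y -> fN (gmul x y);
  fN_inv : forall x, fN x -> fN (ginv x);
  fN_normal : forall g x, fN x -> fN (gmul (ginv g) (gmul x g));
  fN_finidx : exists l : list G, forall x, exists g, In g l /\ fN (gmul (ginv g) x)
}.

(** Elements of G^ = lim G/N are threads (r N)_N of coset representatives,
    compatible along inclusions, modulo coordinatewise equality of cosets. *)
Definition thread (G : Group) (r : FinIdxNormal G -> G) : Prop :=
  forall N M : FinIdxNormal G, (forall x, fN N x -> fN M x) ->
    fN M (gmul (ginv (r N)) (r M)).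

Definition teq (G : Group) (r r' : FinIdxNormal G -> G) : Prop :=
  forall N, fN N (gmul (ginv (r N)) (r' N)).

Definition tmul (G : Group) (r r' : FinIdxNormal G -> G) : FinIdxNormal G -> G :=
  fun N => gmul (r N) (r' N).

(** Continuity of F : G^ -> H^ for the (subspace of the) product topology
    on prod_N G/N, each G/N discrete. *)
Definition tcontinuous (G H : Group)
    (F : (FinIdxNormal G -> G) -> (FinIdxNormal H -> H)) : Prop :=
  forall r, thread r -> forall M : FinIdxNormal H,
    exists Ns : list (FinIdxNormal G), forall r', thread r' ->
      (forall N, In N Ns -> fN N (gmul (ginv (r N)) (r' N))) ->
      fN M (gmul (ginv (F r M)) (F r' M)).

Definition ProfiniteCompletionsIsomorphic (G H : Group) : Prop :=
  exists (F : (FinIdxNormal G -> G) -> (FinIdxNormal H -> H))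
         (F' : (FinIdxNormal H -> H) -> (FinIdxNormal G -> G)),
    (forall r, thread r -> thread (F r)) /\
    (forall r, thread r -> thread (F' r)) /\
    (forall r r', thread r -> thread r' -> teq r r' -> teq (F r) (F r')) /\
    (forall r r', thread r -> thread r' -> teq r r' -> teq (F' r) (F' r')) /\
    (forall r, thread r -> teq (F' (F r)) r) /\
    (forall r, thread r -> teq (F (F' r)) r) /\
    (forall r r', thread r -> thread r' -> teq (F (tmul r r')) (tmul (F r) (F r'))) /\
    tcontinuous F /\ tcontinuous F'.

Fixpoint is_walk (T : Type) (adj : T -> T -> Prop) (x : T) (l : list T) (y : T) : Prop :=
  match l with
  | [] => x = y
  | z :: l' => adj x z /\ is_walk adj z l' y
  end.

Fixpoint consec_adj (T : Type) (adj : T -> T -> Prop) (l : list T) : Prop :=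
  match l with
  | a :: ((b :: _) as l') => adj a b /\ consec_adj adj l'
  | _ => True
  end.

Definition has_cycle (T : Type) (adj : T -> T -> Prop) : Prop :=
  exists (v0 : T) (l : list T),
    NoDup (v0 :: l) /\ 2 <= length l /\ consec_adj adj (v0 :: l) /\
    adj (last l v0) v0.

Definition IsTree (T : Type) (adj : T -> T -> Prop) : Prop :=
  inhabited T /\
  (forall u v, adj u v -> adj v u) /\
  (forall v, ~ adj v v) /\
  (forall u v, exists l, is_walk adj u l v) /\
  ~ has_cycle adj.

Definition TreeActionNoInv (G : Group) (T : Type) (adj : T -> T -> Prop)
    (act : G -> T -> T) : Prop :=
  (forall x, act gone x = x) /\
  (forall g h x, act (gmul g h) x = act g (act h x)) /\
  (forall g u v, adj u v -> adj (act g u) (act g v)) /\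
  (forall g u v, adj u v -> ~ (act g u = v /\ act g v = u)).

Definition PropertyFA (G : Group) : Prop :=
  forall (T : Type) (adj : T -> T -> Prop) (act : G -> T -> T),
    IsTree adj -> TreeActionNoInv adj act ->
    exists x : T, forall g, act g x = x.

(* Main.v *)
(** A Coxeter group has FA exactly when its graph is complete. If [u], [v] are not joined,
    the group is an amalgam of the special subgroups omitting [u], resp. [v], and acts
    without fixed point on the coset tree; the coset graph is a tree because the
    derivation that vanishes on the generators other than [u] and sends [u] to [u e0 - e0]
    turns every edge cochain into a coboundary.

    If [W] is complete and [W'] is not, let [W] act through the common profinite completion
    on the finite quotients of the coset graph of [W']. Each of them has a finite cover
    (given by the same derivation with finite coefficients) on which edge cochains pulled
    back from below become coboundaries, so their limit behaves like a tree. Serre's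
    criterion then holds in the limit: finite cyclic and dihedral groups have fixed points,
    and pairwise intersecting fixed subtrees have a common vertex. Hence [W] fixes a vertex
    in every finite quotient, although the reflection representation over a finite field
    provides a quotient without fixed vertex. The same criterion, applied to an honest
    tree, shows that complete Coxeter groups have FA. *)

From Stdlib Require List Permutation.
From Stdlib Require Import ClassicalEpsilon FunctionalExtensionality PropExtensionality ProofIrrelevance.
From mathcomp Require Import all_boot all_algebra zify ring cyclic finfield.
Require Import Defs.
Set Implicit Arguments.
Unset Strict Implicit.
Unset Printing Implicit Defensive.
Import GRing.Theory.

(** * Groups, actions and Coxeter presentations *)

Section GroupFacts.
Variable G : Group.
Implicit Types x y z : G.

Lemma gmulVK x y : gmul (ginv x) (gmul x y) = y.
Proof. by rewrite gmulA gmulVx gmul1x. Qed.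

Lemma gmulKV x y : gmul x (gmul (ginv x) y) = y.
Proof. by rewrite gmulA gmulxV gmul1x. Qed.

Lemma gmulI x y z : gmul x y = gmul x z -> y = z.
Proof. by move=> h; rewrite -(gmulVK x y) h gmulVK. Qed.

Lemma ginvK x : ginv (ginv x) = x.
Proof. by apply: (@gmulI (ginv x)); rewrite gmulxV gmulVx. Qed.

Lemma ginv_eq x y : gmul x y = gone -> ginv x = y.
Proof. by move=> h; apply: (@gmulI x); rewrite gmulxV h. Qed.

Lemma ginvM x y : ginv (gmul x y) = gmul (ginv y) (ginv x).
Proof. by apply: ginv_eq; rewrite -gmulA gmulKV gmulxV. Qed.

Lemma ginv1 : ginv (@gone G) = gone.
Proof. by apply: ginv_eq; rewrite gmul1x. Qed.

Lemma gpowD x m n : gpow x (m + n) = gmul (gpow x m) (gpow x n).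
Proof. by elim: m => [|m IH] /=; rewrite ?gmul1x // IH gmulA. Qed.

Lemma gpowM x m n : gpow x (m * n) = gpow (gpow x m) n.
Proof. by elim: n => [|n IH] /=; rewrite ?muln0 // mulnS gpowD IH. Qed.

Lemma gpow_comm x n : gmul x (gpow x n) = gmul (gpow x n) x.
Proof. by rewrite -[X in _ = gmul _ X]gmulx1 -(gpowD x n 1) addn1. Qed.

End GroupFacts.

Definition is_action (G : Group) (T : Type) (act : G -> T -> T) : Prop :=
  (forall x, act gone x = x) /\
  (forall g h x, act (gmul g h) x = act g (act h x)).

Section ActionFacts.
Variables (G : Group) (T : Type) (act : G -> T -> T).
Hypothesis actP : is_action act.

Lemma act1 x : act gone x = x. Proof. by case: actP. Qed.
Lemma actM g h x : act (gmul g h) x = act g (act h x). Proof. by case: actP. Qed.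
Lemma actVK g x : act (ginv g) (act g x) = x. Proof. by rewrite -actM gmulVx act1. Qed.
Lemma actKV g x : act g (act (ginv g) x) = x. Proof. by rewrite -actM gmulxV act1. Qed.
Lemma act_inj g x y : act g x = act g y -> x = y.
Proof. by move=> h; rewrite -(actVK g x) h actVK. Qed.
Lemma actX g n x : act (gpow g n) x = iter n (act g) x.
Proof. by elim: n => [|n IH] /=; rewrite ?act1 // actM IH. Qed.

End ActionFacts.

(** * Symmetric groups as targets of the universal property *)

Section Permutations.
Variable S : Type.

Record bij := Bij {
  bfwd : S -> S; bbwd : S -> S;
  bfwdK : forall x, bbwd (bfwd x) = x; bbwdK : forall x, bfwd (bbwd x) = x }.

Lemma bij_eq (f g : bij) : (forall x, bfwd f x = bfwd g x) -> f = g.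
Proof.
case: f g => [f f' fK f'K] [g g' gK g'K] /= efg.
have e : f = g by apply: functional_extensionality.
subst g.
have e : f' = g' by apply: functional_extensionality => x; rewrite -{1}(g'K x) fK.
by subst g'; rewrite (proof_irrelevance _ fK gK) (proof_irrelevance _ f'K g'K).
Qed.

Definition bij1 : bij := @Bij id id (fun=> erefl) (fun=> erefl).

Definition bijM (f g : bij) : bij.
Proof.
exists (bfwd f \o bfwd g) (bbwd g \o bbwd f) => x /=.
  by rewrite !bfwdK.
by rewrite !bbwdK.
Defined.

Definition bijV (f : bij) : bij := Bij (@bbwdK f) (@bfwdK f).

Definition bij_group : Group.
Proof.
refine (@Build_Group bij bijM bijV bij1 _ _ _ _ _) => *; apply: bij_eq => x //=.
  exact: bfwdK.
exact: bbwdK.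
Defined.

End Permutations.

Section CoxeterFacts.
Variables (Gam : CoxGraph) (W : Group) (s : cV Gam -> W).
Hypothesis cox : IsCoxeterPresentation s.

Lemma cox_sq v : gmul (s v) (s v) = gone.
Proof. by case: cox => -[]. Qed.

Lemma cox_inv v : ginv (s v) = s v.
Proof. exact/ginv_eq/cox_sq. Qed.

Lemma cox_rel u v : cadj u v -> gpow (gmul (s u) (s v)) (cm u v) = gone.
Proof. by case: cox => -[_ h] _; apply: h. Qed.

(** The universal property applied to the symmetric group of [S]: an action may be prescribed by
    involutions that satisfy the relations. *)
Lemma coxeter_action (S : Type) (t : cV Gam -> S -> S) :
  (forall v x, t v (t v x) = x) ->
  (forall u v, cadj u v -> forall x, iter (cm u v) (fun y => t u (t v y)) x = x) ->
  exists act : W -> S -> S, is_action act /\ forall v x, act (s v) x = t v x.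
Proof.
move=> tt trel.
pose T v : bij_group S := Bij (tt v) (tt v).
have TP : coxeter_relations T.
  split=> [v | u v auv]; apply: bij_eq => x /=; first exact: tt.
  rewrite -[RHS](trel _ _ auv).
  by elim: (cm u v) => //= n ->.
have [_ /(_ _ _ TP) [f [fM [fs _]]]] := cox.
exists (fun w => bfwd (f w)); split; last by move=> v x; rewrite fs.
have M g h x : bfwd (f (gmul g h)) x = bfwd (f g) (bfwd (f h) x) by rewrite fM.
split=> // x.
(* [is_hom] does not mention the unit: the image of [gone] is an idempotent permutation, hence the
   identity. *)
have := M gone gone x; rewrite gmul1x => /(congr1 (bbwd (f gone))).
by rewrite !bfwdK.
Qed.

Inductive generated : W -> Prop :=
| generated1 : generated gone
| generatedS g v : generated g -> generated (gmul g (s v)).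

Lemma generatedM g h : generated g -> generated h -> generated (gmul g h).
Proof.
move=> gg; elim=> [|k v _ IH]; first by rewrite gmulx1.
by rewrite gmulA; apply: generatedS.
Qed.

Lemma generated_gen v : generated (s v).
Proof. by rewrite -[s v]gmul1x; apply: generatedS generated1. Qed.

Lemma generatedV g : generated g -> generated (ginv g).
Proof.
elim=> [|k v _ IH]; first by rewrite ginv1; apply: generated1.
by rewrite ginvM cox_inv; apply: generatedM (generated_gen v) IH.
Qed.

Lemma sig_eq (T : Type) (P : T -> Prop) (x y : {t | P t}) :
  proj1_sig x = proj1_sig y -> x = y.
Proof.
by case: x y => [x px] [y py] /= e; subst y; rewrite (proof_irrelevance _ px py).
Qed.

Definition generated_group : Group.
Proof.
refine (@Build_Group {g | generated g}
  (fun x y => exist _ _ (generatedM (proj2_sig x) (proj2_sig y)))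
  (fun x => exist _ _ (generatedV (proj2_sig x)))
  (exist _ _ generated1) _ _ _ _ _); move=> *; apply: sig_eq => /=.
- exact: gmulA.
- exact: gmul1x.
- exact: gmulx1.
- exact: gmulVx.
- exact: gmulxV.
Defined.

(** The subgroup of words in the generators receives a homomorphism from [W]. Composed with the
    inclusion it agrees with the identity on the generators, so by uniqueness every element is such
    a word. *)
Lemma coxeter_ind (P : W -> Prop) :
  P gone -> (forall g v, P g -> P (gmul g (s v))) -> forall g, P g.
Proof.
move=> P1 PM g.
suff gg : generated g by elim: gg => // h v _; apply: PM.
have [srel univ] := cox.
pose t v : generated_group := exist _ _ (generated_gen v).
have tP : coxeter_relations t.
  have X (x : generated_group) n : proj1_sig (gpow x n) = gpow (proj1_sig x) n.
    by elim: n => //= n ->.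
  split=> [v | u v auv]; apply: sig_eq; first exact: cox_sq.
  by rewrite X /=; apply: cox_rel.
have [f [fM [fs _]]] := univ _ _ tP.
have [f0 [_ [_ uniq]]] := univ _ _ srel.
rewrite (_ : g = proj1_sig (f g)); first exact: proj2_sig.
rewrite (uniq (fun x => proj1_sig (f x))); last by move=> v; rewrite fs.
  exact: (uniq id).
by move=> x y; rewrite fM.
Qed.

End CoxeterFacts.

(** * Systems of graphs that are acyclic in the limit *)

Section PrimeOrderIteration.
Variables (T : Type) (f : T -> T) (p : nat) (x : T).
Hypotheses (pp : prime p) (fp : iter p f x = x).

Lemma iter_mul_fix m d : iter d f x = x -> iter (m * d) f x = x.
Proof. by move=> fd; elim: m => //= m IH; rewrite mulSn iterD IH. Qed.

(** The orbit of a moved point has exactly [p] elements: a return time prime to [p] would combine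
    with [p], by Bezout, into the return time 1. *)
Lemma iter_eq_mod a b : f x <> x -> iter a f x = iter b f x -> a = b %[mod p].
Proof.
move=> nfx eab.
(* [a * p.-1 + b] stands for [b - a] modulo [p] without subtraction. *)
have eb : iter (a * p.-1 + b) f x = x.
  rewrite iterD -eab -iterD -mulnSr prednK ?prime_gt0 //.
  exact: iter_mul_fix.
have pd : p %| a * p.-1 + b.
  apply: contra_notT nfx; rewrite -prime_coprime // => cop.
  have d0 : 0 < a * p.-1 + b.
    by case: (a * p.-1 + b) cop => //; rewrite prime_coprime // dvdn0.
  case: (egcdnP p d0) => u v e _.
  move: cop; rewrite coprime_sym => /eqP cop.
  by have := iter_mul_fix u eb; rewrite e cop addn1 /= iter_mul_fix.
have : a * p.-1 + b + a = b %[mod p].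
  by rewrite addnAC -mulnSr prednK ?prime_gt0 // modnMDl.
by rewrite -modnDml (eqP pd) add0n.
Qed.

End PrimeOrderIteration.

Lemma sum_cyclic (V : nmodType) n (F : nat -> V) : F n = F 0 ->
  (\sum_(k < n) F k.+1 = \sum_(k < n) F k)%R.
Proof.
by case: n => [|n] e; rewrite ?big_ord0 // big_ord_recr big_ord_recl /= e addrC.
Qed.

Section OrbitRepresentatives.
Variables (T : Type) (f : T -> T).

(** The choice depends only on the forward orbit as a predicate. Along a finite cycle these
    predicates are equal, so all its points get the same representative. *)
Definition orbit_rep (x : T) : T :=
  epsilon (inhabits x) (fun y => exists k, y = iter k f x).

Lemma orbit_repP x : exists k, orbit_rep x = iter k f x.
Proof.
by apply: (epsilon_spec _ (fun y => exists k, y = iter k f x)); exists x, 0.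
Qed.

Lemma orbit_rep_step p x : 0 < p -> iter p f x = x -> orbit_rep (f x) = orbit_rep x.
Proof.
move=> p0 fp; rewrite /orbit_rep.
suff -> : (fun y => exists k, y = iter k f (f x)) = (fun y => exists k, y = iter k f x).
  by apply: epsilon_inh_irrelevance; exists x, 0.
apply: functional_extensionality => y; apply: propositional_extensionality.
split=> -[k ->]; first by exists k.+1; rewrite iterSr.
exists (k + p.-1); rewrite -iterSr -addnS prednK // iterD fp //.
Qed.

Lemma orbit_rep_iter p x k : 0 < p -> iter p f x = x ->
  orbit_rep (iter k f x) = orbit_rep x.
Proof.
move=> p0 fp; elim: k => //= k IH; rewrite (@orbit_rep_step p) //.
by rewrite -iterD addnC iterD fp.
Qed.

Lemma orbit_rep_back p x : 0 < p -> iter p f x = x ->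
  exists2 k, k < p & iter k f x = orbit_rep x.
Proof.
move=> p0 fp; have [k ek] := orbit_repP x.
exists (k %% p); first by rewrite ltn_mod.
rewrite ek {2}(divn_eq k p) addnC iterD.
by congr iter; rewrite -{1}(@iter_mul_fix _ f x (k %/ p) p).
Qed.

End OrbitRepresentatives.

(** The predicates [okv] and [oke] single out an invariant subgraph, because the ambient types may
    contain points outside the graph of interest. Orientations are preserved, so an edge mapped to
    itself has fixed ends. *)
Record wgraph (G : Group) := WGraph {
  vert : Type; edge : Type;
  src : edge -> vert; tgt : edge -> vert;
  vact : G -> vert -> vert; eact : G -> edge -> edge;
  okv : vert -> Prop; oke : edge -> Prop;
  vactP : is_action vact; eactP : is_action eact;
  src_act : forall g e, src (eact g e) = vact g (src e);
  tgt_act : forall g e, tgt (eact g e) = vact g (tgt e);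
  okv_act : forall g x, okv x -> okv (vact g x);
  oke_act : forall g e, oke e -> oke (eact g e);
  ok_src : forall e, oke e -> okv (src e);
  ok_tgt : forall e, oke e -> okv (tgt e) }.

Record wmor (G : Group) (Y X : wgraph G) := WMor {
  mv :> vert Y -> vert X; me : edge Y -> edge X;
  mv_src : forall e, mv (src e) = src (me e);
  mv_tgt : forall e, mv (tgt e) = tgt (me e);
  mv_act : forall g x, mv (vact g x) = vact g (mv x);
  me_act : forall g e, me (eact g e) = eact g (me e);
  mv_ok : forall x, okv x -> okv (mv x);
  me_ok : forall e, oke e -> oke (me e) }.

Definition wmor_comp (G : Group) (Z Y X : wgraph G) (f : wmor Y X) (g : wmor Z Y) :
  wmor Z X.
Proof.
exists (f \o g) (me f \o me g) => //=.
- by move=> e; rewrite !mv_src.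
- by move=> e; rewrite !mv_tgt.
- by move=> h e; rewrite !mv_act.
- by move=> h e; rewrite !me_act.
- by move=> x /(mv_ok g)/(mv_ok f).
- by move=> x /(me_ok g)/(me_ok f).
Defined.

Section Systems.
Variables (G : Group) (I : Type) (gr : I -> wgraph G).

Definition fixv (S : G -> Prop) i (x : vert (gr i)) : Prop :=
  okv x /\ forall s, S s -> vact s x = x.

Definition fixe (S : G -> Prop) i (e : edge (gr i)) : Prop :=
  oke e /\ forall s, S s -> eact s e = e.

(** Fixed vertices of level [j] all map into one component of the fixed subgraph of level [i]; sets
    [chi] closed under fixed edges take the place of paths. *)
Definition joined (S : G -> Prop) i j (f : wmor (gr j) (gr i)) : Prop :=
  forall chi : vert (gr i) -> Prop,
    (forall e, fixe S e -> (chi (src e) <-> chi (tgt e))) ->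
    forall x y, fixv S x -> fixv S y -> chi (f x) -> chi (f y).

(** The analogue of "the fixed subgraph of [S] in the limit of the system is a
    nonempty subtree". *)
Definition good (S : G -> Prop) : Prop := forall i,
  (exists x : vert (gr i), fixv S x) /\ exists j (f : wmor (gr j) (gr i)), joined S f.

(** The inverse limit of the system has no first cohomology with prime coefficients. *)
Definition acyclic : Prop := forall p, prime p -> forall i,
  exists j (f : wmor (gr j) (gr i)), forall psi : edge (gr i) -> 'F_p,
  exists phi : vert (gr j) -> 'F_p,
  forall e, oke e -> psi (me f e) = (phi (tgt e) - phi (src e))%R.

Lemma fixv_src S i (e : edge (gr i)) : fixe S e -> fixv S (src e).
Proof. by case=> oe se; split=> [|s /se {2}<-]; [exact: ok_src | rewrite src_act]. Qed.

Lemma fixv_tgt S i (e : edge (gr i)) : fixe S e -> fixv S (tgt e).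
Proof. by case=> oe se; split=> [|s /se {2}<-]; [exact: ok_tgt | rewrite tgt_act]. Qed.

Lemma fixv_mor S i j (f : wmor (gr j) (gr i)) x : fixv S x -> fixv S (f x).
Proof. by case=> ox sx; split=> [|s /sx {2}<-]; [exact: mv_ok | rewrite mv_act]. Qed.

Lemma fixe_mor S i j (f : wmor (gr j) (gr i)) e : fixe S e -> fixe S (me f e).
Proof. by case=> ox sx; split=> [|s /sx {2}<-]; [exact: me_ok | rewrite me_act]. Qed.

Lemma joined_fun S i j (f : wmor (gr j) (gr i)) (A : Type) (phi : vert (gr i) -> A) :
  joined S f -> (forall e, fixe S e -> phi (src e) = phi (tgt e)) ->
  forall x y, fixv S x -> fixv S y -> phi (f x) = phi (f y).
Proof.
move=> J he x y Sx Sy; apply/esym; apply: (J (fun z => phi z = phi (f x)) _ x y) => //.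
by move=> e /he ->.
Qed.

(** Membership in the subgroup generated by [S], phrased through actions. *)
Definition stab (S : G -> Prop) (h : G) : Prop :=
  forall (T : Type) (act : G -> T -> T), is_action act ->
  forall x, (forall s, S s -> act s x = x) -> act h x = x.

Lemma stabX S h n : stab S h -> stab S (gpow h n).
Proof.
move=> Sh T act aP x Sx; rewrite actX //.
by elim: n => //= n ->; apply: Sh.
Qed.

Lemma good_eq S S' : (forall s, S s -> stab S' s) -> (forall s, S' s -> stab S s) ->
  good S -> good S'.
Proof.
move=> SS' S'S.
have fv i (x : vert (gr i)) : fixv S x <-> fixv S' x.
  split=> -[ox sx]; split=> // s hs.
    exact: (S'S _ hs _ _ (@vactP _ _)).
  exact: (SS' _ hs _ _ (@vactP _ _)).
have fe i (x : edge (gr i)) : fixe S x <-> fixe S' x.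
  split=> -[ox sx]; split=> // s hs.
    exact: (S'S _ hs _ _ (@eactP _ _)).
  exact: (SS' _ hs _ _ (@eactP _ _)).
move=> gS i; have [[x /fv Sx] [j [f J]]] := gS i; split; first by exists x.
exists j, f => chi he y z /fv Sy /fv Sz; apply: J => // e /fe; exact: he.
Qed.

Definition join (S T : G -> Prop) : G -> Prop := fun h => S h \/ T h.

Lemma fixv_join S T i (x : vert (gr i)) : fixv (join S T) x <-> fixv S x /\ fixv T x.
Proof.
split=> [[ox sx] | [[ox sx] [_ tx]]]; last by split=> // s [/sx | /tx].
by split; split=> // s hs; apply: sx; [left | right].
Qed.

Lemma fixe_join S T i (e : edge (gr i)) : fixe (join S T) e <-> fixe S e /\ fixe T e.
Proof.
split=> [[ox sx] | [[ox sx] [_ tx]]]; last by split=> // s [/sx | /tx].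
by split; split=> // s hs; apply: sx; [left | right].
Qed.

Definition adjoin (S : G -> Prop) (g : G) : G -> Prop := fun h => S h \/ h = g.

Hypothesis acyc : acyclic.

(** * Adjoining a normalizing element of prime order modulo [S] *)

Section Transfer.
Variables (S : G -> Prop) (g : G) (p : nat).
Hypotheses (gS : good S) (pp : prime p).
Hypothesis norm : forall s, S s -> stab S (gmul (ginv g) (gmul s g)).
Hypothesis gp : stab S (gpow g p).

Lemma fix_norm (T : Type) (act : G -> T -> T) x : is_action act ->
  (forall s, S s -> act s x = x) -> forall s, S s -> act s (act g x) = act g x.
Proof.
move=> aP Sx s Ss; have := norm Ss aP Sx.
by rewrite !actM // => {2}<-; rewrite actKV.
Qed.

Lemma fixv_norm i (x : vert (gr i)) : fixv S x -> fixv S (vact g x).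
Proof. by case=> ox sx; split; [exact: okv_act | apply: fix_norm => //; apply: vactP]. Qed.

Lemma fixe_norm i (x : edge (gr i)) : fixe S x -> fixe S (eact g x).
Proof. by case=> ox sx; split; [exact: oke_act | apply: fix_norm => //; apply: eactP]. Qed.

Lemma fixv_iter i (x : vert (gr i)) : fixv S x -> iter p (vact g) x = x.
Proof. by case=> _ sx; rewrite -actX; [apply: gp => // | ]; apply: vactP. Qed.

Lemma fixe_iter i (x : edge (gr i)) : fixe S x -> iter p (eact g) x = x.
Proof. by case=> _ sx; rewrite -actX; [apply: gp => // | ]; apply: eactP. Qed.

Local Open Scope ring_scope.

Lemma Fp_mulrn (x : 'F_p) : x *+ p = 0.
Proof. by rewrite -mulr_natr pchar_Fp_0 // mulr0. Qed.

(* An invariant cochain vanishing on fixed edges is a norm, as [g] permutes the other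
   edges freely; on a deeper level it is then the coboundary of a norm. *)
Lemma transfer i : exists j (f : wmor (gr j) (gr i)), forall J : vert (gr i) -> 'F_p,
  (forall e, fixe S e ->
     J (tgt (eact g e)) - J (src (eact g e)) = J (tgt e) - J (src e)) ->
  (forall e, fixe S e -> eact g e = e -> J (tgt e) = J (src e)) ->
  exists N : vert (gr j) -> 'F_p,
  [/\ forall x, fixv S x -> N (vact g x) = N x,
      forall x, fixv S x -> vact g x = x -> N x = 0 &
      forall x y, fixv S x -> fixv S y -> J (f x) - N x = J (f y) - N y].
Proof.
have [j [f acycf]] := acyc pp i.
have [_ [j' [h hJ]]] := gS j.
exists j', (wmor_comp f h) => J Jinv Jfix.
pose dJ e := J (tgt e) - J (src e).
(* All of [dJ] is put on one edge of each orbit, so that summing over a free orbit recovers [dJ]. *)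
pose theta (e : edge (gr i)) : 'F_p :=
  if excluded_middle_informative (orbit_rep (eact g) e = e) then dJ e else 0.
have thetaT e : orbit_rep (eact g) e = e -> theta e = dJ e.
  by rewrite /theta; case: (excluded_middle_informative _).
have thetaF e : orbit_rep (eact g) e <> e -> theta e = 0.
  by rewrite /theta; case: (excluded_middle_informative _).
have p0 := prime_gt0 pp.
have fixk e k : fixe S e -> fixe S (iter k (eact g) e).
  by move=> Se; elim: k => //= k; apply: fixe_norm.
have dJk e k : fixe S e -> dJ (iter k (eact g) e) = dJ e.
  by move=> Se; elim: k => //= k <-; apply: Jinv; apply: fixk.
have thetaS e : fixe S e -> \sum_(k < p) theta (iter k (eact g) e) = dJ e.
  move=> Se; case: (excluded_middle_informative (eact g e = e)) => ge.
    have ek k : iter k (eact g) e = e by elim: k => //= k ->.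
    rewrite [RHS]/dJ (Jfix _ Se ge) subrr big1 // => k _.
    rewrite ek; case: (excluded_middle_informative (orbit_rep (eact g) e = e)).
      by move/thetaT ->; rewrite /dJ Jfix ?subrr.
    exact: thetaF.
  have [k0 k0p ek0] := orbit_rep_back p0 (fixe_iter Se).
  rewrite (bigD1 (Ordinal k0p)) //= big1 ?addr0.
    by rewrite thetaT ?dJk // (@orbit_rep_iter _ _ p) ?ek0 //; apply: fixe_iter.
  move=> k nk; apply: thetaF; rewrite (@orbit_rep_iter _ _ p) ?fixe_iter // -ek0 => ek.
  have := iter_eq_mod pp (fixe_iter Se) ge ek; rewrite !modn_small // => e0; case/eqP: nk; exact/val_inj.
have [phi phiP] := acycf theta.
(* The norm of [phi] is invariant under [g]; at a vertex fixed by [g] it is a sum of [p] equal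
   terms, hence 0. *)
pose N (x : vert (gr j)) : 'F_p := \sum_(k < p) phi (iter k (vact g) x).
have Ng x : fixv S x -> N (vact g x) = N x.
  move=> Sx; have := @sum_cyclic _ p (fun k => phi (iter k (vact g) x)).
  rewrite /= fixv_iter // /N => /(_ erefl) <-.
  by apply: eq_bigr => l _; rewrite -iterSr.
have Nf x : fixv S x -> vact g x = x -> N x = 0.
  move=> Sx gx; rewrite /N (eq_bigr (fun=> phi x)) ?sumr_const ?card_ord ?Fp_mulrn //.
  by move=> l _; congr phi; elim: (nat_of_ord l) => //= m ->.
exists (fun x => N (h x)); split.
- by move=> x Sx; rewrite mv_act Ng //; apply: fixv_mor.
- by move=> x Sx gx; apply: Nf; rewrite -?mv_act ?gx //; apply: fixv_mor.
move=> x y; apply: (joined_fun (phi := fun z => J (f z) - N z) hJ) => e Se.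
have : dJ (me f e) = N (tgt e) - N (src e).
  rewrite -thetaS; last exact: fixe_mor.
  rewrite /N -sumrB; apply: eq_bigr => l _.
  have -> : iter l (eact g) (me f e) = me f (iter l (eact g) e).
    by elim: (nat_of_ord l) => //= m ->; rewrite me_act.
  have [oe _] := Se.
  rewrite phiP; last by elim: (nat_of_ord l) => //= m; apply: oke_act.
  congr (phi _ - phi _); elim: (nat_of_ord l) => //= m <-.
    exact: tgt_act.
  exact: src_act.
rewrite /dJ -mv_src -mv_tgt => eJ.
move/eqP: eJ; rewrite subr_eq => /eqP ->.
by rewrite [RHS]addrC !addrA addNr add0r addrC.
Qed.

(** If [g] moved every vertex fixed by [S], these would form orbits of length [p], and the position
    [J] in the orbit, modulo [p], would grow by 1 under [g]. Its coboundary is invariant, so on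
    images of a deeper level [J] would differ by a constant from an invariant function, a
    contradiction. *)
Lemma transfer_fix i : exists x : vert (gr i), fixv S x /\ vact g x = x.
Proof.
apply: NNPP => nfix.
have free (x : vert (gr i)) : fixv S x -> vact g x <> x by move=> Sx gx; apply: nfix; exists x.
have p0 := prime_gt0 pp.
have cntP (x : vert (gr i)) : exists k, fixv S x -> x = iter k (vact g) (orbit_rep (vact g) x).
  case: (excluded_middle_informative (fixv S x)) => Sx; last by exists 0%N.
  have [k kp <-] := orbit_rep_back p0 (fixv_iter Sx).
  by exists (p - k)%N => _; rewrite -iterD subnK ?fixv_iter // ltnW.
pose cnt x := proj1_sig (constructive_indefinite_description _ (cntP x)).
have cntE x : fixv S x -> x = iter (cnt x) (vact g) (orbit_rep (vact g) x).
  by rewrite /cnt; case: constructive_indefinite_description.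
pose J (x : vert (gr i)) : 'F_p := (cnt x)%:R.
have Jg x : fixv S x -> J (vact g x) = J x + 1.
  move=> Sx; set r := orbit_rep (vact g) x.
  have Sr : fixv S r.
    rewrite /r; have [k ->] := orbit_repP (vact g) x; elim: k => //= k; exact: fixv_norm.
  have eqit : iter (cnt (vact g x)) (vact g) r = iter (cnt x).+1 (vact g) r.
    rewrite /= -cntE // /r -(@orbit_rep_step _ _ p) ?fixv_iter //.
    by rewrite -cntE //; apply: fixv_norm.
  have e := iter_eq_mod pp (fixv_iter Sr) (free _ Sr) eqit.
  by rewrite /J natr1 -(Fp_nat_mod pp) e Fp_nat_mod.
have [j [f /(_ J) [|e Se ge|N [Ng _ JN]]]] := transfer i.
- move=> e Se; rewrite src_act tgt_act !Jg; last 2 first.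
  + exact: fixv_src.
  + exact: fixv_tgt.
  by rewrite opprD addrACA subrr addr0.
- by case: (free _ (fixv_src Se)); rewrite -src_act ge.
have [[x Sx] _] := gS j.
have := JN _ _ (fixv_norm Sx) Sx.
rewrite Ng // mv_act Jg; last exact: fixv_mor.
by rewrite addrAC -[RHS]addr0 => /addrI/eqP; rewrite oner_eq0.
Qed.

(** For connectedness, [transfer] is applied to the indicator of [chi] on the vertices fixed by [S]
    and [g]. The norm vanishes at such vertices, so the indicator is constant on the images of those
    of a deeper level. *)
Lemma good_adjoin_prime : good (adjoin S g).
Proof.
have fixvA i (x : vert (gr i)) : fixv (adjoin S g) x <-> fixv S x /\ vact g x = x.
  split=> [[ox sx] | [[ox sx] gx]]; last by split=> // s [/sx | ->].
  by split; [split=> // s hs | ]; apply: sx; [left | right].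
move=> i; split.
  by have [x Sx] := transfer_fix i; exists x; apply/fixvA.
(* [chi] need not be invariant under [g]; cutting it down to the fixed vertices makes its indicator
   invariant. *)
pose P (chi : vert (gr i) -> Prop) x := (fixv S x /\ vact g x = x) /\ chi x.
pose J chi (x : vert (gr i)) : 'F_p := if excluded_middle_informative (P chi x) then 1 else 0.
have JT chi x : P chi x -> J chi x = 1.
  by rewrite /J; case: (excluded_middle_informative _).
have JF chi x : ~ P chi x -> J chi x = 0.
  by rewrite /J; case: (excluded_middle_informative _).
have Jiff chi x y : (P chi x <-> P chi y) -> J chi x = J chi y.
  move=> h; case: (classic (P chi x)) => a; first by rewrite !JT //; apply/h.
  by rewrite !JF // => b; apply/a/h.
have Jg chi x : fixv S x -> J chi (vact g x) = J chi x.
  move=> Sx; case: (excluded_middle_informative (vact g x = x)) => [-> // | ngx].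
  apply: Jiff; rewrite /P; split=> -[[_ gx] _]; case: ngx => //.
  exact: (act_inj (@vactP _ _) gx).
have [j [f tr]] := transfer i; exists j, f => chi he x y /fixvA [Sx gx] /fixvA [Sy gy] cx.
have [e Se | e Se ge | N [_ N0 /(_ x y Sx Sy)]] := tr (J chi).
- by rewrite src_act tgt_act !Jg //; [apply: fixv_src | apply: fixv_tgt].
- apply: Jiff; rewrite /P.
  have [Ss Sb] := (fixv_src Se, fixv_tgt Se).
  have -> : chi (src e) <-> chi (tgt e).
    by apply: he; case: Se => oe se; split=> // s [/se | ->].
  by rewrite -src_act -tgt_act ge; tauto.
rewrite !N0 // !subr0 JT; last first.
  by split=> //; split; [exact: fixv_mor | rewrite -mv_act gx].
by move=> e; apply: NNPP => ncy; move/eqP: e; rewrite JF ?oner_eq0 // => -[].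
Qed.

End Transfer.

(** Induction on [n]: for a prime [p] dividing [n], first adjoin [h = g^(n/p)], whose [p]-th power
    is [g^n]. Over the larger set [g] satisfies the hypotheses with [n/p] in place of [n]. *)
Lemma good_adjoin S g n : 0 < n -> good S ->
  (forall s, S s -> stab S (gmul (ginv g) (gmul s g))) -> stab S (gpow g n) ->
  good (adjoin S g).
Proof.
have [N] := ubnP n; elim: N n S => // N IH n S nN n0 gS norm gn.
have [n1 | n1] := leqP n 1.
  have e : n = 1 by apply/eqP; rewrite eqn_leq n1.
  move: gn; rewrite e /= gmulx1 => gn.
  apply: good_eq gS => s; first by move=> Ss T act aP x; apply; left.
  by case=> [Ss | -> //] T act aP x; apply.
have pp := pdiv_prime n1; set p := pdiv n in pp.
have en : n = n %/ p * p by rewrite divnK // pdiv_dvd.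
set h := gpow g (n %/ p).
have Sh : good (adjoin S h).
  apply: (good_adjoin_prime gS pp); last by rewrite /h -gpowM -en.
  move=> s Ss T act aP x Sx; rewrite !actM //.
  suff -> : act s (act h x) = act h x by rewrite actVK.
  move: s Ss; rewrite /h; elim: (n %/ p) => [|m IHm] s Ss /=; first by rewrite act1 // Sx.
  rewrite actM //; have := norm s Ss _ _ aP _ IHm.
  by rewrite !actM // => {2}<-; rewrite actKV.
have n'0 : 0 < n %/ p by rewrite divn_gt0 ?prime_gt0 // pdiv_leq.
have : good (adjoin (adjoin S h) g).
  apply: (IH (n %/ p)) => //.
  - by rewrite (leq_trans _ (_ : n <= N)) // ltn_Pdiv ?prime_gt1.
  - move=> s [Ss | ->] T act aP x Sx.
      by apply: norm => // s' Ss'; apply: Sx; left.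
    have -> : gmul (ginv g) (gmul h g) = h by rewrite /h -gpow_comm gmulVK.
    by apply: Sx; right.
  - by move=> T act aP x; apply; right.
apply: good_eq => s; last first.
  by case=> [Ss | ->] T act aP x; apply; [left; left | right].
case=> [[Ss | ->] | ->] T act aP x Sx; [by apply: Sx; left | | by apply: Sx; right].
by apply: (@stabX (adjoin S g)) => // T' act' aP' y; apply; right.
Qed.

(** * Intersections of fixed subtrees and Serre's criterion *)

Local Open Scope ring_scope.

(** A Mayer-Vietoris argument. The cochain [psi], equal to the coboundary of [c] on edges fixed by
    [S] and 0 elsewhere, vanishes on edges fixed by [T]. For its potential [phi], seen from a deeper
    level, [c - phi] is constant on the vertices fixed by [S] and [phi] on those fixed by [T], so
    [c] is constant on the common ones. *)
Lemma good_join S T : good S -> good T ->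
  (forall i, exists x : vert (gr i), fixv S x /\ fixv T x) -> good (join S T).
Proof.
move=> gS gT meet i; split.
  by have [x STx] := meet i; exists x; apply/fixv_join.
have [j [f acycf]] := acyc (isT : prime 2) i.
have [_ [k [g gJ]]] := gS j; have [_ [l [h hJ]]] := gT k.
exists l, (wmor_comp f (wmor_comp g h)) => chi he x y.
move=> /fixv_join [Sx Tx] /fixv_join [Sy Ty].
pose c x : 'F_2 := if excluded_middle_informative (chi x) then 1 else 0.
have c1 z : chi z -> c z = 1 by rewrite /c; case: (excluded_middle_informative _).
have c0 z : ~ chi z -> c z = 0 by rewrite /c; case: (excluded_middle_informative _).
pose psi (e : edge (gr i)) : 'F_2 :=
  if excluded_middle_informative (fixe S e) then c (tgt e) - c (src e) else 0.
have psiS e : fixe S e -> psi e = c (tgt e) - c (src e).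
  by rewrite /psi; case: (excluded_middle_informative _).
have psiT e : fixe T e -> psi e = 0.
  move=> Te; rewrite /psi; case: (excluded_middle_informative _) => // Se.
  have ce : chi (src e) <-> chi (tgt e) by apply: he; apply/fixe_join.
  case: (classic (chi (src e))) => hc; first by rewrite !c1 ?subrr //; apply/ce.
  by rewrite !c0 ?subrr // => /ce.
have [phi phiP] := acycf psi.
have eS : c (f (g (h x))) - phi (g (h x)) = c (f (g (h y))) - phi (g (h y)).
  apply: (joined_fun (phi := fun z => c (f z) - phi z) gJ); try exact: fixv_mor.
  move=> e Se; have [oe _] := Se; have := phiP e oe; rewrite psiS; last exact: fixe_mor.
  rewrite -mv_src -mv_tgt => /eqP; rewrite subr_eq => /eqP ->.
  by rewrite [RHS]addrC !addrA addNr add0r addrC.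
have eT : phi (g (h x)) = phi (g (h y)).
  apply: (joined_fun (phi := fun z => phi (g z)) hJ) => // e Te.
  have [oe _] := fixe_mor g Te; have := phiP _ oe.
  rewrite psiT; last by do 2!apply: fixe_mor.
  by rewrite !mv_src !mv_tgt => /esym/eqP; rewrite subr_eq0 => /eqP.
move: eS; rewrite eT => /addIr e cx; apply: NNPP => ncy.
by move/eqP: e; rewrite c1 // c0 // oner_eq0.
Qed.

(** The Helly property of subtrees. With [c] the indicator of the vertices fixed by [T], the cochain
    [psi] vanishes on edges fixed by [T], and also on those fixed by [U], as no vertex is fixed by
    all three. Going around a triangle of pairwise common vertices yields [1 = 0]. *)
Lemma good_helly S T U : good S -> good T -> good U ->
  (forall i, exists x : vert (gr i), fixv S x /\ fixv T x) ->
  (forall i, exists x : vert (gr i), fixv T x /\ fixv U x) ->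
  (forall i, exists x : vert (gr i), fixv S x /\ fixv U x) ->
  forall i, exists x : vert (gr i), [/\ fixv S x, fixv T x & fixv U x].
Proof.
move=> gS gT gU ST TU SU i; apply: NNPP => none.
have no (x : vert (gr i)) : fixv S x -> fixv T x -> fixv U x -> False.
  by move=> Sx Tx Ux; apply: none; exists x.
have [j [f acycf]] := acyc (isT : prime 2) i.
have [_ [k [g gJ]]] := gS j; have [_ [l [h hJ]]] := gT k.
have [_ [m [q qJ]]] := gU l.
pose c (x : vert (gr i)) : 'F_2 := if excluded_middle_informative (fixv T x) then 1 else 0.
have c1 z : fixv T z -> c z = 1 by rewrite /c; case: (excluded_middle_informative _).
have c0 z : ~ fixv T z -> c z = 0 by rewrite /c; case: (excluded_middle_informative _).
pose psi (e : edge (gr i)) : 'F_2 :=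
  if excluded_middle_informative (fixe S e) then c (tgt e) - c (src e) else 0.
have psiS e : fixe S e -> psi e = c (tgt e) - c (src e).
  by rewrite /psi; case: (excluded_middle_informative _).
have psiT e : fixe T e -> psi e = 0.
  move=> Te; rewrite /psi; case: (excluded_middle_informative _) => // Se.
  by rewrite !c1 ?subrr //; [apply: fixv_src | apply: fixv_tgt].
have psiU e : fixe U e -> psi e = 0.
  move=> Ue; rewrite /psi; case: (excluded_middle_informative _) => // Se.
  rewrite !c0 ?subrr //.
    by move/no; apply; [apply: fixv_src | apply: fixv_src].
  by move/no; apply; [apply: fixv_tgt | apply: fixv_tgt].
have [phi phiP] := acycf psi.
have [x [Sx Tx]] := ST m; have [y [Ty Uy]] := TU m; have [z [Sz Uz]] := SU m.
have eS : c (f (g (h (q x)))) - phi (g (h (q x))) = c (f (g (h (q z)))) - phi (g (h (q z))).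
  apply: (joined_fun (phi := fun z => c (f z) - phi z) gJ); try by do 2!apply: fixv_mor.
  move=> e Se; have [oe _] := Se; have := phiP e oe; rewrite psiS; last exact: fixe_mor.
  rewrite -mv_src -mv_tgt => /eqP; rewrite subr_eq => /eqP ->.
  by rewrite [RHS]addrC !addrA addNr add0r addrC.
have eT : phi (g (h (q x))) = phi (g (h (q y))).
  apply: (joined_fun (phi := fun z => phi (g z)) hJ); try exact: fixv_mor.
  move=> e Te; have [oe _] := fixe_mor g Te; have := phiP _ oe.
  rewrite psiT; last by do 2!apply: fixe_mor.
  by rewrite !mv_src !mv_tgt => /esym/eqP; rewrite subr_eq0 => /eqP.
have eU : phi (g (h (q y))) = phi (g (h (q z))).
  apply: (joined_fun (phi := fun z => phi (g (h z))) qJ) => // e Ue.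
  have [oe _] := fixe_mor g (fixe_mor h Ue); have := phiP _ oe.
  rewrite psiU; last by do 3!apply: fixe_mor.
  by rewrite !mv_src !mv_tgt => /esym/eqP; rewrite subr_eq0 => /eqP.
move: eS; rewrite eT eU => /addIr; rewrite c1 ?c0.
- by move/eqP; rewrite oner_eq0.
- by move=> Tz; apply: (no _ _ Tz); do 4!apply: fixv_mor.
- by do 4!apply: fixv_mor.
Qed.

Hypothesis good0 : good (fun=> False).

(** Serre's criterion: torsion generators with torsion pairwise products. *)
Lemma common_fixed_vertex (A : Type) (t : A -> G) (m : A -> A -> nat) :
  (forall a, gmul (t a) (t a) = gone) ->
  (forall a b, 0 < m a b)%N -> (forall a b, gpow (gmul (t a) (t b)) (m a b) = gone) ->
  forall l : seq A, good (fun h => exists2 a, List.In a l & h = t a).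
Proof.
move=> tt m0 tm l.
pose ts l h := exists2 a, List.In a l & h = t a.
have st1 S : stab S gone by move=> T act aP x _; rewrite act1.
have gens (S : G -> Prop) s : S s -> stab S s by move=> Ss T act aP x; apply.
have g1 g n : (0 < n)%N -> gpow g n = gone -> good (adjoin (fun=> False) g).
  by move=> n0 gn; apply: (good_adjoin n0) => //; rewrite gn.
have tV a : ginv (t a) = t a by apply/ginv_eq/tt.
(* The dihedral group of [t a] and [t b]: the rotations are adjoined first, then [t a], which
   inverts them. *)
have pair a b : good (adjoin (adjoin (fun=> False) (gmul (t a) (t b))) (t a)).
  apply: (@good_adjoin _ _ 2) => //; last by rewrite /= gmulx1 tt.
    exact: g1 (m0 a b) (tm a b).
  move=> s [//|->] T act aP x Sx.
  have -> : gmul (ginv (t a)) (gmul (gmul (t a) (t b)) (t a)) = ginv (gmul (t a) (t b)).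
    by rewrite -gmulA gmulVK ginvM !tV.
  by rewrite -{1}(Sx _ (or_intror erefl)) actVK.
have meet2 a b i : exists x : vert (gr i), fixv (ts [:: a]) x /\ fixv (ts [:: b]) x.
  have [[x [ox sx]] _] := pair a b i; exists x.
  have ax : vact (t a) x = x by apply: sx; right.
  split; split=> // _ [c [<- | []] ->] //.
  have := sx _ (or_introl (or_intror erefl)); rewrite (actM (@vactP _ _)) => abx.
  by apply: (act_inj (@vactP _ _) (g := t a)); rewrite abx ax.
have cons_join a k h : ts (a :: k) h <-> join (ts [:: a]) (ts k) h.
  split=> [[c [<- | cl] ->] | [[c [<- | []] ->] | [c cl ->]]].
  - by left; exists a => //; left.
  - by right; exists c.
  - by exists a => //; left.
  - by exists c => //; right.
have good_cons a k : good (ts (a :: k)) <-> good (join (ts [:: a]) (ts k)).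
  by split; apply: good_eq => s /cons_join; apply: gens.
(* The bound [n] is needed because [a :: b :: l] calls for [a :: l], which is not one of its
   tails. *)
suff H n k : (size k <= n)%N -> good (ts k) by apply: H (leqnn _).
elim: n k => [|n IH] [|a [|b {}l]] //= ln.
- by apply: good_eq good0 => s // [].
- by apply: good_eq good0 => s // [].
- apply: good_eq (g1 (t a) 2 isT _) => [s|s|]; last by rewrite /= gmulx1.
    by case=> // ->; apply: gens; exists a => //; left.
  by case=> c [<- | []] ->; apply: gens; right.
have n1 : (0 < n)%N by case: (n) ln.
have [[ga gb] gbl] := (IH [:: a] n1, IH [:: b] n1, IH (b :: l) ln).
have gal : good (ts (a :: l)) by apply: IH.
have gl : good (ts l) by apply: IH; apply: ltnW.
apply/good_cons/good_join => // i.
(* A vertex fixed by [t a] and by all of [b :: l] comes from Helly for [a], [b] and [l], which meet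
   in pairs by induction. *)
have [|j|j|x [ax bx lx]] := good_helly ga gb gl _ _ _ i.
- by move=> j; apply: meet2.
- by have [[x /fixv_join ?] _] := proj1 (good_cons b l) gbl j; exists x.
- by have [[x /fixv_join ?] _] := proj1 (good_cons a l) gal j; exists x.
exists x; split=> //; case: (bx) => ox _; split=> // s /cons_join.
by case=> hs; [apply: (proj2 bx) | apply: (proj2 lx)].
Qed.

End Systems.

(** * Actions on trees *)

Section Walks.
Variables (T : Type) (adj : T -> T -> Prop).

Lemma is_walk_cat x l y k z : is_walk adj x l y -> is_walk adj y k z -> is_walk adj x (l ++ k) z.
Proof. by elim: l x => [|a l IH] x /= => [-> | [xa /IH]] //; auto. Qed.

Lemma is_walk_split x l a k z : is_walk adj x (l ++ a :: k) z ->
  is_walk adj x (rcons l a) a /\ is_walk adj a k z.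
Proof. by elim: l x => [|b l IH] x /= [xb] => [|/IH[? ?]]. Qed.

Lemma is_walk_rev x l y : (forall u v, adj u v -> adj v u) ->
  is_walk adj x l y -> exists k, is_walk adj y k x.
Proof.
move=> sym; elim: l x => [|a l IH] x /= => [-> | [xa /IH[k yk]]]; first by exists [::].
by exists (k ++ [:: x]); apply: is_walk_cat yk _; split=> //; apply: sym.
Qed.

Lemma not_NoDup (l : seq T) : ~ List.NoDup l ->
  exists l1 z l2 l3, l = l1 ++ z :: l2 ++ z :: l3.
Proof.
elim: l => [[]|a l IH nd]; first exact: List.NoDup_nil.
case: (classic (List.In a l)) => [al | nal].
  by have [l1 [l2 ->]] := List.in_split _ _ al; exists [::], a, l1, l2.
have [|l1 [z [l2 [l3 ->]]]] := IH; first by move=> ndl; apply: nd; constructor.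
by exists (a :: l1), z, l2, l3.
Qed.

Variables (V : zmodType) (om : T -> T -> V).
Hypothesis om_anti : forall x y, om y x = (- om x y)%R.
Hypothesis tree : IsTree adj.
Local Open Scope ring_scope.

Fixpoint wsum x (l : seq T) : V :=
  if l is z :: l' then om x z + wsum z l' else 0.

Lemma wsum_cat x l y k : is_walk adj x l y -> wsum x (l ++ k) = wsum x l + wsum y k.
Proof. by elim: l x => [|a l IH] x /= => [-> | [_ /IH ->]]; rewrite ?add0r ?addrA. Qed.

Lemma consec_walk x l y : is_walk adj x (rcons l y) y ->
  consec_adj adj (x :: l) /\ adj (List.last l x) y.
Proof.
elim: l x => [|a l IH] x /=; first by case.
case=> xa /IH [ca la]; split=> //.
change (adj (List.last (a :: l) x) y); suff -> : List.last (a :: l) x = List.last l a by [].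
clear; elim: l a x => [//|b l IH] a x.
by transitivity (List.last l b); [apply: IH | rewrite -(IH b a)].
Qed.

(* A shortest closed walk with nonzero sum would be a cycle. *)
Lemma wsum_closed x l : is_walk adj x l x -> wsum x l = 0.
Proof.
have [_ [_ [irr [_ acyc]]]] := tree.
have [N] := ubnP (size l); elim: N x l => // N IH x l sl wl.
case: (classic (List.NoDup l)) => [nd | /not_NoDup [l1 [z [l2 [l3 e]]]]]; last first.
  have sz : (size l = size l1 + size l2 + size l3 + 2)%N.
    by rewrite e !size_cat /= size_cat /=; lia.
  move: wl; rewrite e => wl.
  have [w1 w23] := is_walk_split wl.
  have [w2 w3] := is_walk_split w23.
  rewrite -cat_rcons (wsum_cat _ w1) -cat_rcons (wsum_cat _ w2).
  rewrite (IH z (rcons l2 z)) //; last by rewrite size_rcons; move: sl; rewrite sz; lia.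
  rewrite add0r -(wsum_cat _ w1); apply: IH; last exact: is_walk_cat w1 w3.
  by rewrite size_cat size_rcons; move: sl; rewrite sz; lia.
case/lastP: l nd wl {sl} => [// | l y] nd wl.
have yx : y = x.
  move: wl; rewrite -cats1 => /is_walk_split [_ /=]; exact.
subst y; case: l nd wl => [|a [|b l]] nd wl.
- by case: wl => /irr.
- by rewrite /= addr0 (om_anti x a) subrr.
case: acyc; exists x, (a :: b :: l); have [c1 c2] := consec_walk wl.
split; last by split=> //; rewrite /=; lia.
apply: (Permutation.Permutation_NoDup _ nd); rewrite -cats1.
exact/Permutation.Permutation_sym/Permutation.Permutation_cons_append.
Qed.

(** The potential is the sum along any walk from a base point; the walk does not matter because
    closed walks have sum zero. *)
Lemma tree_potential : exists h : T -> V, forall x y, adj x y -> om x y = h y - h x.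
Proof.
have [[x0] [sym [_ [conn _]]]] := tree.
pose h x := wsum x0 (proj1_sig (constructive_indefinite_description _ (conn x0 x))).
have hP x l : is_walk adj x0 l x -> h x = wsum x0 l.
  rewrite /h; case: constructive_indefinite_description => k /= wk wl.
  have [r wr] := is_walk_rev sym wl.
  have := wsum_closed (is_walk_cat wk wr); have := wsum_closed (is_walk_cat wl wr).
  by rewrite (wsum_cat _ wk) (wsum_cat _ wl) => <- /addIr.
exists h => x y xy; have [l wl] := conn x0 x.
rewrite (hP x l wl) (hP y (l ++ [:: y])); last by apply: is_walk_cat wl _.
by rewrite (wsum_cat _ wl) /= addr0 addrC addKr.
Qed.

End Walks.

Definition wmor_id (G : Group) (X : wgraph G) : wmor X X.
Proof. by exists id id. Defined.

(** The barycentric subdivision of a tree: its vertices are the sets [{x}] and [{x, y}]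
    with [x] adjacent to [y], its oriented edges the pairs [(x, y)]. *)
Section Subdivision.
Variables (G : Group) (T : Type) (adj : T -> T -> Prop) (act : G -> T -> T).
Hypotheses (tree : IsTree adj) (noinv : TreeActionNoInv adj act).

Lemma tree_act : is_action act.
Proof. by case: noinv => ? []. Qed.

Definition doublet (x y : T) : T -> Prop := fun z => z = x \/ z = y.

Definition translate (g : G) (P : T -> Prop) : T -> Prop := fun z => P (act (ginv g) z).

Lemma translate_action : is_action translate.
Proof.
split=> [P | g h P]; apply: functional_extensionality => z; rewrite /translate.
  by rewrite ginv1 (act1 tree_act).
by rewrite ginvM (actM tree_act).
Qed.

Lemma translate_doublet g x y : translate g (doublet x y) = doublet (act g x) (act g y).
Proof.
apply: functional_extensionality => z; apply: propositional_extensionality.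
rewrite /translate /doublet; split=> -[e | e]; [left | right | left | right];
by rewrite ?e ?(actVK tree_act) // -e (actKV tree_act).
Qed.

Lemma doublet_sing x a b : doublet x x = doublet a b -> x = a /\ x = b.
Proof.
move=> e; have [ax bx] : doublet x x a /\ doublet x x b by rewrite e; split; [left | right].
by split; [case: ax | case: bx].
Qed.

Lemma doublet_inj x y a b : doublet x y = doublet a b ->
  (x = a /\ y = b) \/ (x = b /\ y = a).
Proof.
move=> e; have [xP yP] : doublet a b x /\ doublet a b y by rewrite -e; split; [left | right].
have [aP bP] : doublet x y a /\ doublet x y b by rewrite e; split; [left | right].
by rewrite /doublet in xP yP aP bP; intuition congruence.
Qed.

Definition subdivision : wgraph G.
Proof.
refine (@WGraph G (T -> Prop) (T * T) (fun e => doublet e.1 e.1) (fun e => doublet e.1 e.2)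
  translate (fun g e => (act g e.1, act g e.2))
  (fun P => exists x y, P = doublet x y /\ (x = y \/ adj x y)) (fun e => adj e.1 e.2)
  translate_action _ _ _ _ _ _ _).
- by split=> [[x y] | g h [x y]]; rewrite /= ?(act1 tree_act) ?(actM tree_act).
- by move=> g e; rewrite translate_doublet.
- by move=> g e; rewrite translate_doublet.
- move=> g _ [x [y [-> xy]]]; exists (act g x), (act g y); rewrite translate_doublet.
  split=> //; case: xy => [-> | xy]; first by left.
  by right; case: noinv => _ [_ [h _]]; apply: h.
- by move=> g [x y] /= xy; case: noinv => _ [_ [h _]]; apply: h.
- by move=> [x y] _; exists x, x; split=> //; left.
- by move=> [x y] xy; exists x, y; split=> //; right.
Defined.

(** The difference of [psi] on the two halves of a tree edge is antisymmetric, so it has a potential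
    [h] on the tree. The midpoint of [x] and [y] gets [psi (x, y) + h x], which is symmetric in [x]
    and [y] by the choice of [h]. *)
Lemma subdivision_acyclic : acyclic (fun _ : unit => subdivision).
Proof.
move=> p pp i; exists i, (wmor_id _) => /= psi.
have [_ [sym _]] := tree.
have [h hP] := @tree_potential _ _ _ (fun x y => psi (x, y) - psi (y, x))%R
  (fun x y => esym (opprB _ _)) tree.
pose val P v := (exists x, P = doublet x x /\ v = h x) \/
  exists x y, [/\ adj x y, P = doublet x y & v = psi (x, y) + h x]%R.
have irr x : ~ adj x x by case: tree => _ [_ []].
have uniq P v w : val P v -> val P w -> v = w.
  case=> [[x [-> ->]] | [x [y [xy -> ->]]]] [[a [e ->]] | [a [b [ab e ->]]]].
  - by have [-> _] := doublet_sing e.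
  - by have [xa xb] := doublet_sing e; move: ab; rewrite -xa -xb => /irr.
  - by have [ax ay] := doublet_sing (esym e); move: xy; rewrite -ax -ay => /irr.
  have [[-> ->] // | [ex ey]] := doublet_inj e; subst a b.
  have := hP _ _ xy => /= /eqP; rewrite subr_eq => /eqP ->.
  by rewrite addrAC subrK addrC.
pose phi P := epsilon (inhabits 0%R) (val P).
have phiP P v : val P v -> phi P = v.
  by move=> Pv; apply: (uniq P _ _ _ Pv); apply: (epsilon_spec _ (val P)); exists v.
exists phi => -[x y] /= xy.
rewrite (phiP (doublet x x) (h x)); last by rewrite /val; left; exists x.
rewrite (phiP _ (psi (x, y) + h x)%R) ?addrK //.
by rewrite /val; right; exists x, y.
Qed.

(** With nothing to fix, the condition is that the subdivision is nonempty and connected. *)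
Lemma subdivision_good : good (fun _ : unit => subdivision) (fun=> False).
Proof.
have [[x0] [sym [_ [conn _]]]] := tree.
move=> i; split; first by exists (doublet x0 x0); split=> //; exists x0, x0; split=> //; left.
exists i, (wmor_id _) => chi he P Q [[x [y [-> xy]]] _] [[a [b [-> ab]]] _] /=.
have edge u v : adj u v -> chi (doublet u u) <-> chi (doublet u v).
  by move=> uv; apply: (he (u, v)); split.
have doubletC u v : doublet u v = doublet v u.
  apply: functional_extensionality => z; apply: propositional_extensionality.
  by rewrite /doublet; tauto.
have step u v : adj u v -> chi (doublet u u) -> chi (doublet v v).
  by move=> uv /(edge _ _ uv); rewrite doubletC => /edge; apply; apply: sym.
have walk u l v : is_walk adj u l v -> chi (doublet u u) -> chi (doublet v v).
  by elim: l u => [|z l IH] u /= => [-> // | [uz /IH zv] /(step _ _ uz)].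
have half u v : (u = v \/ adj u v) -> chi (doublet u u) <-> chi (doublet u v).
  by case=> [-> // | /edge].
have [l xa] := conn x a.
by move/(half _ _ xy)/(walk _ _ _ xa)/(half _ _ ab).
Qed.

(** The ends of a fixed midpoint are fixed, since exchanging them would be an inversion. *)
Lemma subdivision_fixed (P : T -> Prop) : okv (w := subdivision) P ->
  (forall g, translate g P = P) -> exists x, forall g, act g x = x.
Proof.
case=> x [y [-> xy]] fixP; exists x => g; have := fixP g; rewrite translate_doublet.
case/doublet_inj => [[] // | [gx gy]]; case: xy => [e | xy]; first by rewrite gx.
by case: noinv => _ [_ [_ /(_ g x y xy)]]; case.
Qed.

End Subdivision.

(** * Complete Coxeter groups have FA *)

Definition complete (Gam : CoxGraph) : Prop :=
  forall u v : cV Gam, u <> v -> cadj u v.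

Lemma complete_exponents (Gam : CoxGraph) : complete Gam ->
  exists m : cV Gam -> cV Gam -> nat, (forall u v, 0 < m u v) /\
  forall (W : Group) (s : cV Gam -> W), coxeter_relations s ->
  forall u v, gpow (gmul (s u) (s v)) (m u v) = gone.
Proof.
move=> comp.
(* On the diagonal the product is the square of a generator, so the exponent 1 serves. *)
exists (fun u v => if excluded_middle_informative (u = v) then 1 else cm u v).
split=> [u v | W s [sq rel] u v]; case: (excluded_middle_informative _) => // uv.
- by apply: ltnW; apply/leP/cm_ge2/comp.
- by rewrite /= gmulx1 uv.
- exact/rel/comp.
Qed.

Lemma complete_FA (Gam : CoxGraph) (W : Group) (s : cV Gam -> W) :
  IsCoxeterPresentation s -> complete Gam -> PropertyFA W.
Proof.
move=> cox comp T adj act tree noinv.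
have [m [m0 mP]] := complete_exponents comp.
have [l lP] := cV_finite Gam.
have [[P [okP fixP]] _] := common_fixed_vertex (subdivision_acyclic tree noinv)
  (subdivision_good tree noinv) (cox_sq cox) m0 (mP _ _ (proj1 cox)) l tt.
apply: (subdivision_fixed okP).
apply: (coxeter_ind cox); first by rewrite (act1 (translate_action noinv)).
move=> g v gP; rewrite (actM (translate_action noinv)).
suff -> : translate act (s v) P = P by [].
by apply: fixP; exists v.
Qed.

(** * Finite covers and finite quotients *)

Definition finite_type (T : Type) : Prop := exists l : list T, forall x, List.In x l.

(** Graphs shaped like the Bass--Serre graph of the decomposition of [W] as the amalgam
    of the subgroups generated by the [s w] with [w <> u], resp. [w <> v]. *)
Section Covers.
Variables (Gam : CoxGraph) (W : Group) (s : cV Gam -> W) (u v : cV Gam).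
Hypotheses (cox : IsCoxeterPresentation s) (uv : u <> v) (nuv : ~ cadj u v).

Record bgraph := BGraph {
  bV : Type; bE : Type;
  bsrc : bE -> bV; btgt : bE -> bV;
  bvact : W -> bV -> bV; beact : W -> bE -> bE;
  bvactP : is_action bvact; beactP : is_action beact;
  bsrc_act : forall g e, bsrc (beact g e) = bvact g (bsrc e);
  btgt_act : forall g e, btgt (beact g e) = bvact g (btgt e);
  bbase : bE;
  bbase_src : forall w, w <> u -> bvact (s w) (bsrc bbase) = bsrc bbase;
  bbase_tgt : forall w, w <> v -> bvact (s w) (btgt bbase) = btgt bbase;
  bbase_fix : forall w, w <> u -> w <> v -> beact (s w) bbase = bbase }.

Section Fiber.
Variables (X : bgraph) (M : zmodType).
Local Open Scope ring_scope.

(** Formal combinations of edges are represented by their values on all cochains. The type is finite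
    as soon as the edges and [M] are. *)
Definition fiber : Type := (bE X -> M) -> M.

Definition rho (g : W) (c : fiber) : fiber := fun psi => c (fun e => psi (beact g e)).

Lemma rhoP : is_action rho.
Proof.
have aP := @beactP X.
split=> [c | g h c]; apply: functional_extensionality => psi; congr c;
apply: functional_extensionality => e; by rewrite ?(act1 aP) ?(actM aP).
Qed.

(* The formal difference [u e0 - e0] of edges, evaluated on cochains, is the value at [u]
   of a derivation vanishing at the other generators; no relation links [u] and [v]. *)
Definition fgen (w : cV Gam) (c : fiber) : fiber :=
  if excluded_middle_informative (w = u)
  then fun psi => rho (s w) c psi + (psi (beact (s w) (bbase X)) - psi (bbase X))
  else rho (s w) c.

Definition fshift (c : fiber) (e : bE X) : fiber := fun psi => c psi - psi e.

Lemma fgen_ne w c : w <> u -> fgen w c = rho (s w) c.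
Proof. by rewrite /fgen; case: (excluded_middle_informative _). Qed.

Lemma fgen_u c : fgen u c =
  fun psi => rho (s u) c psi + (psi (beact (s u) (bbase X)) - psi (bbase X)).
Proof. by rewrite /fgen; case: (excluded_middle_informative _). Qed.

Definition unshift (c : fiber) : fiber := fun psi => c psi + psi (bbase X).

Lemma unshift_inj c d : unshift c = unshift d -> c = d.
Proof.
move=> e; apply: functional_extensionality => psi.
exact: (addIr _ (congr1 (fun f => f psi) e)).
Qed.

(** On the generators other than [v] the derivation is inner: adding the base edge [e0] turns the
    twisted action into translation, as [u c + (u e0 - e0) + e0 = u (c + e0)]. *)
Lemma unshift_fgen w c : w <> v -> unshift (fgen w c) = rho (s w) (unshift c).
Proof.
move=> wv; apply: functional_extensionality => psi; rewrite /unshift.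
case: (classic (w = u)) => [-> | wu]; first by rewrite fgen_u /rho -addrA subrK.
by rewrite fgen_ne // /rho bbase_fix.
Qed.

Lemma fgenK w c : fgen w (fgen w c) = c.
Proof.
have sq d : rho (s w) (rho (s w) d) = d.
  by rewrite -(actM rhoP) (cox_sq cox) (act1 rhoP).
case: (classic (w = u)) => wu; last by rewrite !fgen_ne.
by apply: unshift_inj; rewrite !unshift_fgen ?sq // wu.
Qed.

(** A relation that involves [u] avoids [v], since the two are not adjacent, and [unshift] carries
    it to a relation between translations. A relation without [u] is already one between
    translations. *)
Lemma fgen_rel w x : cadj w x -> forall c,
  iter (cm w x) (fun d => fgen w (fgen x d)) c = c.
Proof.
move=> wx c.
have rel d : iter (cm w x) (fun d => rho (s w) (rho (s x) d)) d = d.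
  rewrite -[RHS](act1 rhoP) -(cox_rel cox wx) (actX rhoP).
  by elim: (cm w x) => //= n ->; rewrite (actM rhoP).
case: (classic (w = u \/ x = u)) => [wxu | nu].
  have [wv xv] : w <> v /\ x <> v.
    split=> e; rewrite e in wx wxu; case: wxu => e'; first [by case: uv
      | by apply: nuv; rewrite -e' | by apply: nuv; apply: cadj_sym; rewrite -e'].
  apply: unshift_inj; rewrite -[RHS]rel.
  by elim: (cm w x) => //= n <-; rewrite !unshift_fgen.
have [wu xu] : w <> u /\ x <> u by tauto.
by rewrite -[RHS]rel; elim: (cm w x) => //= n <-; rewrite !fgen_ne.
Qed.

Lemma fiber_action : exists act : W -> fiber -> fiber,
  is_action act /\ forall w c, act (s w) c = fgen w c.
Proof. by apply: (coxeter_action cox) => [w c | w x /fgen_rel]; [apply: fgenK |]. Qed.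

Definition fact := proj1_sig (constructive_indefinite_description _ fiber_action).

Lemma factP : is_action fact.
Proof. by rewrite /fact; case: constructive_indefinite_description => ? []. Qed.

Lemma fact_gen w c : fact (s w) c = fgen w c.
Proof. by rewrite /fact; case: constructive_indefinite_description => ? [] /=. Qed.

Lemma fact_shift g e c : fact g (fshift c e) = fshift (fact g c) (beact g e).
Proof.
move: g e c; apply: (coxeter_ind cox) => [e c | g w IH e c].
  by rewrite !(act1 factP) (act1 (@beactP _)).
rewrite !(actM factP) (actM (@beactP _)) -IH; congr fact; rewrite !fact_gen.
apply: functional_extensionality => psi.
case: (classic (w = u)) => [-> | wu]; last by rewrite !fgen_ne.
by rewrite !fgen_u /rho /fshift addrAC.
Qed.

(** Crossing the lift of an edge [e] lowers the fibre coordinate by [e]. Hence minus the evaluation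
    at a cochain of [X] is a potential of its pullback. *)
Definition cover : bgraph.
Proof.
refine (@BGraph (bV X * fiber) (bE X * fiber)
  (fun e => (bsrc e.1, e.2)) (fun e => (btgt e.1, fshift e.2 e.1))
  (fun g x => (bvact g x.1, fact g x.2)) (fun g e => (beact g e.1, fact g e.2))
  _ _ _ _ (bbase X, fun=> 0) _ _ _).
- by split=> [[x c] | g h [x c]];
  rewrite /= ?(act1 (@bvactP _)) ?(act1 factP) ?(actM (@bvactP _)) ?(actM factP).
- by split=> [[x c] | g h [x c]];
  rewrite /= ?(act1 (@beactP _)) ?(act1 factP) ?(actM (@beactP _)) ?(actM factP).
- by move=> g [e c] /=; rewrite bsrc_act.
- by move=> g [e c] /=; rewrite btgt_act fact_shift.
- by move=> w wu /=; rewrite bbase_src // fact_gen fgen_ne.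
(* The target of the new base edge has fibre coordinate [- e0], which [unshift] sends to 0. *)
- move=> w wv /=; rewrite bbase_tgt // fact_gen; congr pair; apply: unshift_inj.
  rewrite unshift_fgen //; apply: functional_extensionality => psi.
  by rewrite /rho /unshift /fshift !sub0r !addNr.
- by move=> w wu wv /=; rewrite bbase_fix // fact_gen fgen_ne.
Defined.

Lemma cover_coboundary (psi : bE X -> M) (e : bE cover) :
  psi e.1 = - (btgt e).2 psi - - (bsrc e).2 psi.
Proof. by rewrite /= /fshift opprB opprK subrK. Qed.

End Fiber.
End Covers.

(** * Finite types and subgroups of finite index *)

Section FiniteTypes.

Lemma finite_prod (A B : Type) : finite_type A -> finite_type B -> finite_type (A * B).
Proof.
by move=> [l lP] [k kP]; exists (List.list_prod l k) => -[a b]; apply/List.in_prod.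
Qed.

Lemma finite_sum (A B : Type) : finite_type A -> finite_type B -> finite_type (A + B).
Proof.
move=> [l lP] [k kP]; exists (List.map inl l ++ List.map inr k) => x.
by apply/List.in_or_app; case: x => x; [left | right]; apply: List.in_map.
Qed.

Lemma finite_fintype (A : finType) : finite_type A.
Proof.
exists (enum A) => x; have : x \in enum A by rewrite mem_enum.
by elim: (enum A) => //= a l IH; rewrite inE => /orP [/eqP -> | /IH]; [left | right].
Qed.

Lemma finite_fun (A B : Type) : finite_type A -> finite_type B -> finite_type (A -> B).
Proof.
move=> [l lP] [k kP].
suff [L LP] : exists L : seq (A -> B), forall f, exists2 g, List.In g L &
    forall a, List.In a l -> f a = g a.
  exists L => f; have [g gL fg] := LP f.
  by rewrite (_ : f = g) //; apply: functional_extensionality => a; apply/fg/lP.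
elim: l {lP} => [|a l [L LP]].
  case: (classic (inhabited (A -> B))) => [[f0] | nf].
    by exists [:: f0] => f; exists f0 => //; left.
  by exists [::] => f; case: nf; constructor.
pose upd (g : A -> B) b x := if excluded_middle_informative (x = a) then b else g x.
exists (List.map (fun gb => upd gb.1 gb.2) (List.list_prod L k)) => f.
have [g gL fg] := LP f; exists (upd g (f a)).
  by apply/List.in_map_iff; exists (g, f a); split=> //; apply/List.in_prod.
move=> x xl; rewrite /upd; case: (excluded_middle_informative _) => xa /=; first by rewrite xa.
by apply: fg; case: xl => // /esym.
Qed.

End FiniteTypes.

Section FiniteIndex.
Variable G : Group.

(** One preimage of each attained value of [c] suffices to represent all cosets. *)
Lemma finite_index_of_map (N : G -> Prop) (K : Type) (c : G -> K) (l : list K) :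
  (forall x, List.In (c x) l) -> (forall x y, c x = c y -> N (gmul (ginv x) y)) ->
  exists r : list G, forall x, exists g, List.In g r /\ N (gmul (ginv g) x).
Proof.
move=> cl cN.
suff [r rP] : exists r : list G, forall x, List.In (c x) l ->
    exists g, List.In g r /\ c g = c x.
  by exists r => x; have [g [gr /cN ?]] := rP x (cl x); exists g.
elim: l {cl} => [|a l [r rP]]; first by exists [::].
case: (classic (exists x, c x = a)) => [[x0 e0] | nx].
  exists (x0 :: r) => x [<- | /rP [g [gr e]]]; first by exists x0; split=> //; left.
  by exists g; split=> //; right.
by exists r => x [e | /rP //]; case: nx; exists x.
Qed.

Variables (T : Type) (act : G -> T -> T).
Hypotheses (actP : is_action act) (Tfin : finite_type T).

Definition kernel : FinIdxNormal G.
Proof.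
refine (@Build_FinIdxNormal G (fun g => forall x, act g x = x) _ _ _ _ _).
- by move=> x; rewrite (act1 actP).
- by move=> g h gP hP x; rewrite (actM actP) hP gP.
- by move=> g gP x; rewrite -{1}(gP x) (actVK actP).
- by move=> g h hP x; rewrite !(actM actP) hP (actVK actP).
have [L LP] := finite_fun Tfin Tfin.
apply: (@finite_index_of_map (fun g => forall x, act g x = x) _ act L) => [g | g h e x]; first exact: LP.
by rewrite (actM actP) -e (actVK actP).
Defined.

Definition meet (N M : FinIdxNormal G) : FinIdxNormal G.
Proof.
refine (@Build_FinIdxNormal G (fun g => fN N g /\ fN M g) _ _ _ _ _).
- by split; apply: fN_one.
- by move=> g h [gN gM] [hN hM]; split; apply: fN_mul.
- by move=> g [gN gM]; split; apply: fN_inv.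
- by move=> g h [hN hM]; split; apply: fN_normal.
have [l lP] := fN_finidx N; have [k kP] := fN_finidx M.
pose c x := (proj1_sig (constructive_indefinite_description _ (lP x)),
             proj1_sig (constructive_indefinite_description _ (kP x))).
have cP x : [/\ List.In (c x) (List.list_prod l k),
    fN N (gmul (ginv (c x).1) x) & fN M (gmul (ginv (c x).2) x)].
  rewrite /c; do 2!case: constructive_indefinite_description => ? [? ?] /=.
  by split=> //; apply/List.in_prod.
apply: (@finite_index_of_map (fun g => fN N g /\ fN M g) _ c (List.list_prod l k)) => [x | x y e].
  by case: (cP x).
have [[_ xN xM] [_ yN yM]] := (cP x, cP y).
have q a : gmul (ginv x) y = gmul (ginv (gmul (ginv a) x)) (gmul (ginv a) y).
  by rewrite ginvM ginvK -gmulA gmulKV.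
split.
  by rewrite (q (c x).1); apply: fN_mul; [apply: fN_inv | rewrite e].
by rewrite (q (c x).2); apply: fN_mul; [apply: fN_inv | rewrite e].
Defined.

Lemma meet_list (Ns : list (FinIdxNormal G)) (N0 : FinIdxNormal G) :
  exists N : FinIdxNormal G, forall M, List.In M Ns -> forall x, fN N x -> fN M x.
Proof.
elim: Ns => [|M Ns [N NP]]; first by exists N0.
exists (meet M N) => M' [<- | MN] x [xM xN] //; exact: (NP M').
Qed.

End FiniteIndex.

(** * From an isomorphism of completions to maps into finite quotients *)

Section ProfiniteMaps.
Variables W W' : Group.
Hypothesis iso : ProfiniteCompletionsIsomorphic W W'.

(** The dense image of [W] in the completion of [W'], seen in each finite quotient. *)
Lemma profinite_maps : exists phi : FinIdxNormal W' -> W -> W',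
  [/\ forall N x y, fN N (gmul (ginv (phi N (gmul x y))) (gmul (phi N x) (phi N y))),
      forall N M x, (forall g, fN N g -> fN M g) -> fN M (gmul (ginv (phi N x)) (phi M x)) &
      forall N g, exists x, fN N (gmul (ginv (phi N x)) g)].
Proof.
have [F [F' [thF [thF' [eqF [eqF' [F'F [FF' [FM [cF cF']]]]]]]]]] := iso.
have cst (H : Group) (x : H) : thread (fun=> x).
  by move=> N M _; rewrite gmulVx; apply: fN_one.
exists (fun N x => F (fun=> x) N); split.
- by move=> N x y; apply: (FM (fun=> x) (fun=> y)).
- by move=> N M x NM; apply: thF.
move=> N g; set r := F' (fun=> g).
have thr : thread r by apply: thF'.
have [Ns NsP] := cF r thr N.
(* The kernel of the trivial action is the whole group, a starting point for the intersection of the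
   list. *)
have triv : is_action (fun (_ : W) (x : unit) => x) by [].
have fin : finite_type unit by exists [:: tt] => -[]; left.
have [N0 N0P] := meet_list Ns (kernel triv fin).
(* [F] sends [r] to the constant thread [g]. By continuity, [F r] modulo [N] is governed by the
   coordinates in [Ns], where [r] agrees with the constant thread [r N0]. *)
exists (r N0).
have e1 : fN N (gmul (ginv (F r N)) (F (fun=> r N0) N)).
  apply: NsP => // M /N0P NM; have := fN_inv (thr N0 M NM).
  by rewrite ginvM ginvK.
have e2 : fN N (gmul (ginv (F r N)) g) by apply: FF'.
have := fN_mul (fN_inv e1) e2.
by rewrite ginvM ginvK -gmulA gmulKV.
Qed.

End ProfiniteMaps.

(** * Reflection representations over finite fields *)

Section Field.
Local Open Scope ring_scope.

(* Choose the field such that [2 * m] divides its number of units for all [m] in [ms]. *)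
Lemma field_with_roots (ms : seq nat) : exists F : finFieldType,
  (2%:R : F) != 0 /\ forall m, m \in ms -> (1 < m)%N ->
  exists y : F, y ^+ (2 * m) = 1 /\ y ^+ 2 != 1.
Proof.
pose n := (2 * \prod_(m <- ms | 1 < m) m)%N.
have n0 : (0 < n)%N.
  rewrite muln_gt0 /=; elim: ms {n} => [|m ms IH]; first by rewrite big_nil.
  by rewrite big_cons; case: ifP => // m1; rewrite muln_gt0 IH ltnW.
have dvd_n m : m \in ms -> (1 < m)%N -> (2 * m %| n)%N.
  move=> mms m1; rewrite dvdn_pmul2l //; elim: ms {n n0} mms => // a ms IH.
  rewrite inE big_cons => /orP [/eqP <- | /IH d]; first by rewrite m1 dvdn_mulr.
  by case: ifP => // _; apply: dvdn_mull.
(* A prime above [n] is coprime to it, so by Euler [n] divides [p ^ totient n - 1], the number of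
   units of the field with [p ^ totient n] elements. *)
have [p np pp] := prime_above n.
have cop : coprime p n by rewrite prime_coprime // gtnNdvd.
have t0 : (0 < totient n)%N by rewrite totient_gt0.
have [F [charF cardF]] := pPrimePowerField pp t0.
have dvd_card : (n %| #|F|.-1)%N.
  rewrite cardF -subn1 -eqn_mod_dvd ?expn_gt0 ?prime_gt0 //.
  by apply/eqP/Euler_exp_totient.
have c1 : (1 < #|F|)%N by apply: finRing_gt1.
have units (x : F) : x != 0 -> x ^+ #|F|.-1 = 1.
  move=> x0; apply: (mulfI x0); rewrite -exprS prednK ?expf_card ?mulr1 //; exact: ltnW.
exists F; split.
  have -> : (2%:R != 0 :> F) = ~~ (p %| 2)%N by rewrite (dvdn_pcharf charF).
  by rewrite gtnNdvd // (leq_ltn_trans _ np) // leq_pmulr // -(ltn_pmul2l (isT : 0 < 2)%N).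
move=> m mms m1; have [k ek] : exists k, #|F|.-1 = (k * (2 * m))%N.
  by apply/dvdnP; apply: dvdn_trans dvd_card; apply: dvd_n.
have k0 : (0 < 2 * k)%N.
  have : (0 < #|F|.-1)%N by rewrite -ltnS prednK // ltnW.
  by rewrite ek; case: (k).
(* As [#|F|.-1] is [2 * m * k], the power [x ^+ k] is the required [y]. Such an [x] exists because
   ['X^(2 * k) - 1] has at most [2 * k] roots, fewer than the nonzero elements. *)
suff [x x0 xk] : exists2 x : F, x != 0 & x ^+ (2 * k) != 1.
  by exists (x ^+ k); rewrite -!exprM -ek units // mulnC.
have [x /andP [x0 xk] | none] := pickP [pred x : F | (x != 0) && (x ^+ (2 * k) != 1)].
  by exists x.
have := @max_poly_roots _ ('X^(2 * k) - 1%:P) (enum (predC1 (0 : F))).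
rewrite -size_poly_eq0 size_XnsubC // -cardE cardC1 ek => /(_ isT) H.
suff : (k * (2 * m) < (2 * k).+1)%N by nia.
apply: H; rewrite ?enum_uniq //; apply/allP => x; rewrite mem_enum => x0.
have := none x; rewrite /= inE in x0 *; rewrite x0 => /negbT; rewrite negbK => /eqP xk.
by rewrite rootE !hornerE xk subrr.
Qed.

End Field.

Section Reflections.
Local Open Scope ring_scope.
Variables (V : Type) (F : fieldType) (a : V -> V -> F).
Hypothesis diag : forall w, a w w = 2%:R.

(** The contragredient reflection: [f] is a functional given by its values on the simple roots, and
    [a] plays the role of the Cartan matrix. *)
Definition reflect_at (w : V) (f : V -> F) : V -> F := fun z => f z - f w * a w z.

Lemma reflect_atK w f : reflect_at w (reflect_at w f) = f.
Proof. by apply: functional_extensionality => z; rewrite /reflect_at diag; ring. Qed.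

(* The coefficients produced by alternating the two reflections satisfy the recursion
   [c (k+2) = - (y + y^-1) c (k+1) - c k], whence [c k = (-1)^k (P y^k + Q y^-k)]. *)
Lemma reflect_at_rel w x y m : y ^+ (2 * m) = 1 -> y ^+ 2 != 1 -> (0 < m)%N ->
  a w x = y + y^-1 -> a x w = y + y^-1 ->
  forall f, iter m (fun g => reflect_at w (reflect_at x g)) f = f.
Proof.
move=> ym y2 m0 awx axw f.
have y0 : y != 0.
  by apply/eqP => y0; move/eqP: ym; rewrite y0 expr0n muln_eq0 /= eqn0Ngt m0 eq_sym oner_eq0.
have yy : y ^+ 2 - 1 != 0 by rewrite subr_eq0.
(* [P] and [Q] solve the initial conditions [P + Q = f x] and [P / y + Q * y = f w]. *)
pose P := (y * f x - f w) * y / (y ^+ 2 - 1); pose Q := f x - P.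
(* The geometric sum [1 + t + ... + t^(k-1)]; at [k = m] it vanishes for [t = y^2] and
   [t = y^-2]. *)
pose sg k (t : F) := (t ^+ k - 1) / (t - 1).
have inv k : [/\ iter k (fun g => reflect_at w (reflect_at x g)) f x
      = P * (y ^+ 2) ^+ k + Q * (y^-1 ^+ 2) ^+ k,
    iter k (fun g => reflect_at w (reflect_at x g)) f w
      = (y + y^-1) * (P * (y ^+ 2) ^+ k + Q * (y^-1 ^+ 2) ^+ k)
        - (P * y * (y ^+ 2) ^+ k + Q * y^-1 * (y^-1 ^+ 2) ^+ k) &
    forall z, iter k (fun g => reflect_at w (reflect_at x g)) f z
      = f z - (P * sg k (y ^+ 2) + Q * sg k (y^-1 ^+ 2)) * a x z
        + (P * y * sg k (y ^+ 2) + Q * y^-1 * sg k (y^-1 ^+ 2)) * a w z].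
  elim: k => [|k [IHx IHw IHz]]; rewrite /sg.
    split=> [||z] /=; rewrite !expr0.
    - by rewrite /Q; ring.
    - by rewrite /Q /P; field; rewrite y0 yy.
    - by rewrite !subrr !mul0r !mulr0 !addr0 !mul0r subr0 addr0.
  have step z : reflect_at w (reflect_at x (iter k (fun g => reflect_at w (reflect_at x g)) f)) z
     = iter k (fun g => reflect_at w (reflect_at x g)) f z
       - (P * (y ^+ 2) ^+ k + Q * (y^-1 ^+ 2) ^+ k) * a x z
       + (P * y * (y ^+ 2) ^+ k + Q * y^-1 * (y^-1 ^+ 2) ^+ k) * a w z.
    by rewrite /reflect_at IHx IHw axw; ring.
  split=> [||z] /=; rewrite step ?IHx ?IHw ?IHz ?diag ?awx ?axw !exprS.
  - by field.
  - by field.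
  - rewrite /sg; field.
    by rewrite y0 -expr2 yy mulN1r -opprB oppr_eq0 yy.
apply: functional_extensionality => z; have [_ _ ->] := inv m.
rewrite /sg -!exprM !exprVn ym invr1 !subrr !mul0r !mulr0 !addr0 !mul0r subr0 addr0 //.
Qed.

End Reflections.

Section Separation.
Variables (Gam : CoxGraph) (W : Group) (s : cV Gam -> W) (u : cV Gam).
Hypothesis cox : IsCoxeterPresentation s.
Local Open Scope ring_scope.

(** The subgroup generated by the [s w] with [w <> u] fixes the coordinate at [u] in the
    dual reflection representation. *)
Lemma coxeter_separation : exists (S : Type) (act : W -> S -> S) (x0 : S),
  [/\ finite_type S, is_action act, forall w, w <> u -> act (s w) x0 = x0 &
      act (s u) x0 <> x0].
Proof.
have [l lP] := cV_finite Gam.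
pose ms := List.map (fun e => cm e.1 e.2) (List.list_prod l l).
have In_mem (k : seq nat) x : List.In x k -> x \in k.
  by elim: k => //= b k IH [-> | /IH xk]; rewrite inE ?eqxx ?xk ?orbT.
have msP (w x : cV Gam) : cm w x \in ms.
  by apply/In_mem/List.in_map_iff; exists (w, x); split=> //; exact/List.in_prod.
have [F [two roots]] := field_with_roots ms.
pose good_root m (y : F) := y ^+ (2 * m) = 1 /\ y ^+ 2 != 1.
(* The root is a function of the label alone, which makes [a] symmetric. *)
pose root m := epsilon (inhabits (0 : F)) (good_root m).
have rootP (w x : cV Gam) : cadj w x -> good_root (cm w x) (root (cm w x)).
  move=> wx; have := roots _ (msP w x) (introT leP (cm_ge2 wx)).
  exact: (epsilon_spec _ (good_root _)).
pose a (w x : cV Gam) : F := if excluded_middle_informative (w = x) then 2%:R else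
  root (cm w x) + (root (cm w x))^-1.
have diag w : a w w = 2%:R by rewrite /a; case: (excluded_middle_informative _).
have off w x : w <> x -> a w x = root (cm w x) + (root (cm w x))^-1.
  by rewrite /a; case: (excluded_middle_informative _).
have [|w x wx f|act [actP actE]] := coxeter_action cox (t := reflect_at a).
- exact: reflect_atK.
- have [y1 y2] := rootP _ _ wx.
  have nwx : w <> x by move=> e; case: (@cadj_irrefl _ x); rewrite {1}e in wx.
  apply: (reflect_at_rel diag y1 y2); rewrite ?off //.
  + exact/ltnW/leP/cm_ge2.
  + by rewrite cm_sym.
  + by move=> e; apply: nwx.
(* The reflection at [w] fixes a functional that vanishes at [w], whereas the one at [u] changes the
   value of [x0] at [u] from 1 to [1 - 2]. *)
pose x0 (w : cV Gam) : F := if excluded_middle_informative (w = u) then 1 else 0.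
have x0u : x0 u = 1 by rewrite /x0; case: (excluded_middle_informative _).
have x0n w : w <> u -> x0 w = 0 by rewrite /x0; case: (excluded_middle_informative _).
exists (cV Gam -> F), act, x0; split=> //.
- by apply: finite_fun; [exists l | apply: finite_fintype].
- move=> w wu; rewrite actE; apply: functional_extensionality => z.
  by rewrite /reflect_at (x0n w) // mul0r subr0.
rewrite actE => /(congr1 (fun f => f u)); rewrite /reflect_at x0u diag.
by move/eqP; rewrite subr_eq addrC -subr_eq subrr mul1r eq_sym (negPf two).
Qed.

End Separation.

(** * The tower of finite quotients *)

Section Tower.
Variables (Gam' : CoxGraph) (W' : Group) (s' : cV Gam' -> W') (u v : cV Gam').
Hypotheses (cox' : IsCoxeterPresentation s') (uv : u <> v) (nuv : ~ cadj u v).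
Variables (W : Group) (phi : FinIdxNormal W' -> W -> W').
Hypotheses
  (phiM : forall N x y, fN N (gmul (ginv (phi N (gmul x y))) (gmul (phi N x) (phi N y))))
  (phi_compat : forall N M x, (forall g, fN N g -> fN M g) ->
    fN M (gmul (ginv (phi N x)) (phi M x)))
  (phi_onto : forall N g, exists x, fN N (gmul (ginv (phi N x)) g)).

Record fgraph := FGraph {
  fgr :> bgraph s' u v;
  fgr_V : finite_type (bV fgr);
  fgr_E : finite_type (bE fgr) }.

Definition sum_act (X : fgraph) (g : W') (x : bV X + bE X) : bV X + bE X :=
  match x with inl y => inl (bvact g y) | inr e => inr (beact g e) end.

Lemma sum_actP (X : fgraph) : is_action (@sum_act X).
Proof.
split=> [[x | e] | g h [x | e]] /=;
by rewrite ?(act1 (@bvactP _ _ _ _ _ _)) ?(act1 (@beactP _ _ _ _ _ _))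
           ?(actM (@bvactP _ _ _ _ _ _)) ?(actM (@beactP _ _ _ _ _ _)).
Qed.

Definition fker (X : fgraph) : FinIdxNormal W' :=
  kernel (sum_actP X) (finite_sum (fgr_V X) (fgr_E X)).

Lemma fker_act (X : fgraph) x y : fN (fker X) (gmul (ginv x) y) ->
  (forall z : bV X, bvact x z = bvact y z) /\ (forall e : bE X, beact x e = beact y e).
Proof.
move=> h; split=> z.
  have [] := h (inl z); rewrite (actM (@bvactP _ _ _ _ _ _)) => {1}<-.
  by rewrite (actKV (@bvactP _ _ _ _ _ _)).
have [] := h (inr z); rewrite (actM (@beactP _ _ _ _ _ _)) => {1}<-.
by rewrite (actKV (@beactP _ _ _ _ _ _)).
Qed.

Lemma phi1 N : fN N (phi N gone).
Proof. by have := phiM N gone gone; rewrite gmul1x gmulVK. Qed.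

(** [W] acts through [phi] modulo the kernel of the action of [W'] on [X], where [phi] is
    multiplicative. Only the orbit of the base edge counts, as [X] may have further components. *)
Definition pull (X : fgraph) : wgraph W.
Proof.
refine (@WGraph W (bV X) (bE X) (@bsrc _ _ _ _ _ X) (@btgt _ _ _ _ _ X)
  (fun w x => bvact (phi (fker X) w) x) (fun w e => beact (phi (fker X) w) e)
  (fun x => exists g, x = bvact g (bsrc (bbase X)) \/ x = bvact g (btgt (bbase X)))
  (fun e => exists g, e = beact g (bbase X)) _ _ _ _ _ _ _ _).
- split=> [x | g h x]; first by case: (phi1 (fker X) (inl x)).
  by rewrite (proj1 (fker_act (phiM (fker X) g h))) (actM (@bvactP _ _ _ _ _ _)).
- split=> [x | g h x]; first by case: (phi1 (fker X) (inr x)).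
  by rewrite (proj2 (fker_act (phiM (fker X) g h))) (actM (@beactP _ _ _ _ _ _)).
- by move=> g e; apply: bsrc_act.
- by move=> g e; apply: btgt_act.
- move=> w _ [g [-> | ->]]; exists (gmul (phi (fker X) w) g).
    by left; rewrite (actM (@bvactP _ _ _ _ _ _)).
  by right; rewrite (actM (@bvactP _ _ _ _ _ _)).
- by move=> w _ [g ->]; exists (gmul (phi (fker X) w) g); rewrite (actM (@beactP _ _ _ _ _ _)).
- by move=> _ [g ->]; exists g; left; rewrite bsrc_act.
- by move=> _ [g ->]; exists g; right; rewrite btgt_act.
Defined.

Lemma finite_fiber (X : fgraph) (p : nat) : finite_type (fiber X 'F_p).
Proof.
apply: finite_fun; last exact: finite_fintype.
by apply: finite_fun; [exact: fgr_E | exact: finite_fintype].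
Qed.

Definition fcover (X : fgraph) (p : nat) : fgraph :=
  @FGraph (cover cox' uv nuv X 'F_p) (finite_prod (fgr_V X) (finite_fiber X p))
    (finite_prod (fgr_E X) (finite_fiber X p)).

Lemma fcover_ker (X : fgraph) (p : nat) g : fN (fker (fcover X p)) g -> fN (fker X) g.
Proof.
pose c : fiber X 'F_p := fun=> 0%R.
move=> h [x | e] /=; first by case: (h (inl (x, c))) => ->.
by case: (h (inr (e, c))) => ->.
Qed.

(** Equivariance rests on [phi_compat]: the two levels use [phi] modulo different kernels, one
    contained in the other. *)
Definition fcover_mor (X : fgraph) (p : nat) : wmor (pull (fcover X p)) (pull X).
Proof.
refine (@WMor W (pull (fcover X p)) (pull X) fst fst _ _ _ _ _ _).
- by [].
- by [].
- by move=> w x; rewrite /= (proj1 (fker_act (phi_compat w (@fcover_ker X p)))).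
- by move=> w x; rewrite /= (proj2 (fker_act (phi_compat w (@fcover_ker X p)))).
- by move=> _ [g [-> | ->]]; exists g; [left | right].
- by move=> _ [g ->]; exists g.
Defined.

Lemma tower_acyclic : acyclic pull.
Proof.
move=> p pp X; exists (fcover X p), (fcover_mor X p) => psi.
exists (fun x => - x.2 psi)%R => e _; exact: (@cover_coboundary _ _ _ _ _ cox' uv nuv X 'F_p psi e).
Qed.

(** The orbit of the base edge is connected: passing from [g] to [g s'_w] keeps the source when
    [w <> u], and for [w = u] it keeps the target, which is adjacent to both sources. *)
Lemma tower_good : good pull (fun=> False).
Proof.
move=> X; split.
  by exists (bsrc (bbase X)); split=> //; exists gone; left; rewrite (act1 (@bvactP _ _ _ _ _ _)).
exists X, (wmor_id _) => chi he.
set a := bsrc (bbase X); set b := btgt (bbase X).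
have edge g : chi (bvact g a) <-> chi (bvact g b).
  have := he (beact g (bbase X)); rewrite /= bsrc_act btgt_act; apply; split=> //.
  by exists g.
have orb g : chi (bvact g a) <-> chi a.
  move: g; apply: (coxeter_ind cox'); first by rewrite (act1 (@bvactP _ _ _ _ _ _)).
  move=> g w IH; apply: iff_trans IH; have [wu | wu] := classic (w = u); last first.
    by rewrite (actM (@bvactP _ _ _ _ _ _)) bbase_src.
  have := edge (gmul g (s' w)); rewrite !(actM (@bvactP _ _ _ _ _ _)) bbase_tgt ?wu // => e.
  exact: iff_trans e (iff_sym (edge g)).
have all x : okv (w := pull X) x -> chi x <-> chi a.
  case=> g [-> | ->]; first exact: orb.
  exact: iff_trans (iff_sym (edge g)) (orb g).
by move=> x y [ox _] [oy _] /= /(all x ox)/(all y oy).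
Qed.

(** The complete bipartite graph on two finite sets that separate [u], resp. [v], from the other
    generators. *)
Lemma separating_graph : exists X : fgraph,
  bvact (s' u) (bsrc (bbase X)) <> bsrc (bbase X) /\
  bvact (s' v) (btgt (bbase X)) <> btgt (bbase X).
Proof.
have [S [f [x0 [fS fP f0 fu]]]] := coxeter_separation u cox'.
have [T [h [y0 [fT hP h0 hv]]]] := coxeter_separation v cox'.
pose actV g (z : S + T) := match z with inl x => inl (f g x) | inr y => inr (h g y) end.
have actVP : is_action actV.
  by split=> [[x | y] | g g' [x | y]]; rewrite /= ?(act1 fP) ?(act1 hP) ?(actM fP) ?(actM hP).
pose actE g (e : S * T) := (f g e.1, h g e.2).
have actEP : is_action actE.
  by split=> [[x y] | g g' [x y]]; rewrite /actE /= ?(act1 fP) ?(act1 hP) ?(actM fP) ?(actM hP).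
pose X := @BGraph _ _ s' u v (S + T) (S * T) (fun e => inl e.1) (fun e => inr e.2) actV actE
  actVP actEP (fun _ _ => erefl) (fun _ _ => erefl) (x0, y0)
  (fun w wu => congr1 inl (f0 w wu)) (fun w wv => congr1 inr (h0 w wv))
  (fun w wu wv => f_equal2 pair (f0 w wu) (h0 w wv)).
exists (@FGraph X (finite_sum fS fT) (finite_prod fS fT)); split=> /= -[]; [exact: fu | exact: hv].
Qed.

(** By Serre's criterion [W] fixes a vertex of the separating graph. As [phi] is onto modulo the
    kernel, so does [W']; after translation this vertex is an end of the base edge, which [s' u] or
    [s' v] moves. *)
Lemma no_complete_source (Gam : CoxGraph) (s : cV Gam -> W) :
  IsCoxeterPresentation s -> complete Gam -> False.
Proof.
move=> cox comp.
have [m [m0 mP]] := complete_exponents comp.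
have [l lP] := cV_finite Gam.
have [X [nu nv]] := separating_graph.
have [[x [okx fixx]] _] := common_fixed_vertex tower_acyclic tower_good
  (cox_sq cox) m0 (mP _ _ (proj1 cox)) l X.
have fixW w : vact (w := pull X) w x = x.
  move: w; apply: (coxeter_ind cox) => [|g a gx]; first by rewrite (act1 (@vactP _ (pull X))).
  by rewrite (actM (@vactP _ (pull X))) fixx //; exists a.
have fixW' g : bvact g x = x.
  have [w /fker_act [<- _]] := phi_onto (fker X) g; exact: fixW.
have conj g z : x = bvact g z -> forall h : W', bvact h z = z.
  move=> xz h; apply: (act_inj (@bvactP _ _ _ _ _ _) (g := g)).
  rewrite -(actM (@bvactP _ _ _ _ _ _)).
  have -> : gmul g h = gmul (gmul (gmul g h) (ginv g)) g by rewrite -gmulA gmulVx gmulx1.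
  by rewrite (actM (@bvactP _ _ _ _ _ _)) -xz fixW'.
by case: okx => g [/conj/(_ (s' u)) | /conj/(_ (s' v))].
Qed.

End Tower.

(** * The coset tree *)

(** The function [phi] shows the edge to be a bridge: in a cycle through it, the remaining edges
    would join its ends while keeping [phi] constant. *)
Lemma no_cycle_of_cuts (T A : Type) (adj : T -> T -> Prop) :
  (forall x y, adj x y -> exists2 phi : T -> A, phi x <> phi y &
     forall a b, adj a b -> (a = x /\ b = y) \/ (a = y /\ b = x) \/ phi a = phi b) ->
  ~ has_cycle adj.
Proof.
move=> cut [x [l [nd [l2 [c zx]]]]].
case: l nd l2 c zx => [|y [|z l]] nd /= l2; [lia | lia | move=> [xy c] zx].
have [phi nphi phiP] := cut x y xy; apply: nphi.
have [nx ndy] := proj1 (List.NoDup_cons_iff _ _) nd.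
have [ny _] := proj1 (List.NoDup_cons_iff _ _) ndy.
have const : forall k a, (forall b, List.In b (a :: k) -> b <> x) ->
    consec_adj adj (a :: k) -> phi a = phi (List.last (a :: k) x).
  elim=> [|b k IH] a out //= [ab ck].
  have -> : phi a = phi b.
    case: (phiP a b ab) => [[ax _] | [[_ bx] | //]].
      by case: (out a) => //; left.
    by case: (out b) => //; right; left.
  by apply: IH => // w wk; apply: out; right.
set w := List.last (y :: z :: l) x.
have lastIn : List.In w (z :: l).
  rewrite /w; change (List.In (List.last (z :: l) x) (z :: l)).
  elim: (l) z {zx nd nx ndy ny c w cut const} => [|a k IH] z; first by left.
  by right; apply: IH.
have yw : phi y = phi w.
  by apply: const => // b byl bx; apply: nx; rewrite -bx.
rewrite yw; case: (phiP w x zx) => [[wx _] | [[wy _] | //]].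
  by case: nx; rewrite -wx; right.
by case: ny; rewrite -wy.
Qed.

Section CosetTree.
Variables (Gam : CoxGraph) (W : Group) (s : cV Gam -> W) (u v : cV Gam).
Hypotheses (cox : IsCoxeterPresentation s) (uv : u <> v) (nuv : ~ cadj u v).

Inductive special (P : cV Gam -> Prop) : W -> Prop :=
| special1 : special P gone
| specialS g w : special P g -> P w -> special P (gmul g (s w)).

Lemma specialM P g h : special P g -> special P h -> special P (gmul g h).
Proof.
move=> Pg; elim=> [|k w _ IH Pw]; first by rewrite gmulx1.
by rewrite gmulA; apply: specialS.
Qed.

Lemma special_gen (P : cV Gam -> Prop) w : P w -> special P (s w).
Proof. by move=> Pw; rewrite -[s w]gmul1x; apply: specialS => //; apply: special1. Qed.

Lemma specialV P g : special P g -> special P (ginv g).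
Proof.
elim=> [|k w _ IH Pw]; first by rewrite ginv1; apply: special1.
by rewrite ginvM (cox_inv cox); apply: specialM IH; apply: special_gen.
Qed.

Lemma special_fix P (T : Type) (act : W -> T -> T) x : is_action act ->
  (forall w, P w -> act (s w) x = x) -> forall g, special P g -> act g x = x.
Proof.
move=> aP Px g; elim=> [|k w _ IH Pw]; first by rewrite (act1 aP).
by rewrite (actM aP) Px.
Qed.

Definition ltrans (g : W) (P : W -> Prop) : W -> Prop := fun x => P (gmul (ginv g) x).

Lemma ltransP : is_action ltrans.
Proof.
split=> [P | g h P]; apply: functional_extensionality => x; rewrite /ltrans.
  by rewrite ginv1 gmul1x.
by rewrite ginvM gmulA.
Qed.

(** For a coset [P] of a subgroup of [A] this is the coset of [A] containing [P], obtained without a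
    representative. *)
Definition set_mul (P A : W -> Prop) : W -> Prop :=
  fun x => exists y, P y /\ A (gmul (ginv y) x).

Lemma ltrans_mul g P A : set_mul (ltrans g P) A = ltrans g (set_mul P A).
Proof.
apply: functional_extensionality => x; apply: propositional_extensionality.
split=> -[y [Py Ay]].
  by exists (gmul (ginv g) y); split=> //; rewrite ginvM ginvK -gmulA gmulKV.
exists (gmul g y); rewrite /ltrans gmulVK; split=> //.
by rewrite ginvM -gmulA.
Qed.

Lemma special_mul (P Q : cV Gam -> Prop) : (forall w, P w -> Q w) ->
  set_mul (special P) (special Q) = special Q.
Proof.
move=> PQ; apply: functional_extensionality => x; apply: propositional_extensionality.
split=> [[y [Py Qy]] | Qx]; last by exists gone; split; [apply: special1 | rewrite ginv1 gmul1x].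
rewrite -(gmulKV y x); apply: specialM => //.
by elim: Py => [|g w _ IH /PQ]; [apply: special1 | apply: specialS].
Qed.

Lemma ltrans_special P g : ltrans g (special P) = special P <-> special P g.
Proof.
split=> [e | Pg].
  have : ltrans g (special P) g by rewrite /ltrans gmulVx; apply: special1.
  by rewrite e.
apply: functional_extensionality => x; apply: propositional_extensionality.
split=> h; last by apply: specialM h; apply: specialV.
by rewrite -(gmulKV g x); apply: specialM h.
Qed.

Definition coset_graph : bgraph s u v.
Proof.
pose A := special (fun w => w <> u); pose B := special (fun w => w <> v).
refine (@BGraph _ _ s u v ((W -> Prop) + (W -> Prop)) (W -> Prop)
  (fun P => inl (set_mul P A)) (fun P => inr (set_mul P B))
  (fun g x => match x with inl P => inl (ltrans g P) | inr P => inr (ltrans g P) end)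
  ltrans _ ltransP _ _ (special (fun w => w <> u /\ w <> v)) _ _ _).
- by split=> [[P | P] | g h [P | P]]; rewrite ?(act1 ltransP) ?(actM ltransP).
- by move=> g P; rewrite ltrans_mul.
- by move=> g P; rewrite ltrans_mul.
- move=> w wu; congr inl; rewrite special_mul; last by move=> ? [].
  by apply/ltrans_special/special_gen.
- move=> w wv; congr inr; rewrite special_mul; last by move=> ? [].
  by apply/ltrans_special/special_gen.
- by move=> w wu wv; apply/ltrans_special/special_gen.
Defined.

Let X := coset_graph.
Let a0 : bV X := bsrc (bbase X).
Let b0 : bV X := btgt (bbase X).

Lemma src_stabilizer g : bvact g a0 = a0 -> special (fun w => w <> u) g.
Proof.
move=> [] e; apply/ltrans_special; move: e.
by rewrite special_mul // => w [].
Qed.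

Lemma tgt_stabilizer g : bvact g b0 = b0 -> special (fun w => w <> v) g.
Proof.
move=> [] e; apply/ltrans_special; move: e.
by rewrite special_mul // => w [].
Qed.

(** The stabilizers of [a0] and [b0] are generated by elements that also fix the ends of the base
    edge of the cover. So [g a0] and [g b0] lift consistently, and the potential on the cover
    restricts along this section. *)
Lemma coset_coboundary (psi : bE X -> 'F_2) : exists phi : bV X -> 'F_2,
  forall g, (psi (beact g (bbase X)) = phi (bvact g b0) - phi (bvact g a0))%R.
Proof.
pose Y := cover cox uv nuv X 'F_2.
pose val (x : bV Y) : 'F_2 := (- x.2 psi)%R.
pose a1 := bsrc (bbase Y); pose b1 := btgt (bbase Y).
pose R x m := (exists g, x = bvact g a0 /\ m = val (bvact g a1)) \/
              (exists g, x = bvact g b0 /\ m = val (bvact g b1)).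
have aY := @bvactP _ _ _ _ _ Y; have aX := @bvactP _ _ _ _ _ X.
have ediv (z : bV X) g h : bvact g z = bvact h z -> bvact (gmul (ginv h) g) z = z.
  by move=> e; rewrite (actM aX) e (actVK aX).
have emul (z : bV Y) g h : bvact (gmul (ginv h) g) z = z -> bvact g z = bvact h z.
  by rewrite (actM aY) => {2}<-; rewrite (actKV aY).
have uniq x m m' : R x m -> R x m' -> m = m'.
  case=> -[g [-> ->]] [] [h [e ->]]; try by [].
    congr val; apply/emul/(special_fix aY)/src_stabilizer/ediv/e.
    exact: bbase_src.
  congr val; apply/emul/(special_fix aY)/tgt_stabilizer/ediv/e.
  exact: bbase_tgt.
exists (fun x => epsilon (inhabits 0%R) (R x)) => g.
have spec x m : R x m -> epsilon (inhabits 0%R) (R x) = m.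
  by move=> Rm; apply: (uniq x _ _ _ Rm); apply: (epsilon_spec _ (R x)); exists m.
rewrite (spec (bvact g a0) (val (bvact g a1))); last by left; exists g.
rewrite (spec (bvact g b0) (val (bvact g b1))); last by right; exists g.
rewrite -bsrc_act -btgt_act; exact: (cover_coboundary psi (beact g (bbase Y))).
Qed.

Definition coset_vertex : Type :=
  {x : bV X | exists g, x = bvact g a0 \/ x = bvact g b0}.

Definition va (g : W) : coset_vertex := exist _ (bvact g a0) (ex_intro _ g (or_introl erefl)).
Definition vb (g : W) : coset_vertex := exist _ (bvact g b0) (ex_intro _ g (or_intror erefl)).

Definition coset_adj (x y : coset_vertex) : Prop :=
  exists g, (x = va g /\ y = vb g) \/ (x = vb g /\ y = va g).

Lemma coset_vertexP x : exists g, x = va g \/ x = vb g.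
Proof.
case: x => x [g xg]; exists g.
by case: xg => e; [left | right]; apply: sig_eq.
Qed.

Lemma va_vb g h : va g <> vb h.
Proof. by move=> /(congr1 (@proj1_sig _ _)). Qed.

Lemma va_gen g w : w <> u -> va (gmul g (s w)) = va g.
Proof.
move=> wu; apply: sig_eq; change (bvact (gmul g (s w)) a0 = bvact g a0).
by rewrite (actM (@bvactP _ _ _ _ _ X)) bbase_src.
Qed.

Lemma vb_gen g w : w <> v -> vb (gmul g (s w)) = vb g.
Proof.
move=> wv; apply: sig_eq; change (bvact (gmul g (s w)) b0 = bvact g b0).
by rewrite (actM (@bvactP _ _ _ _ _ X)) bbase_tgt.
Qed.

Lemma coset_tree : IsTree coset_adj.
Proof.
have sym x y : coset_adj x y -> coset_adj y x.
  by case=> g [[-> ->] | [-> ->]]; exists g; [right | left].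
split; first by constructor; exact: (va gone).
split=> //; split.
  by move=> x [g [[-> e] | [-> e]]]; [| symmetry in e]; case: (va_vb e).
split; last first.
  apply: (@no_cycle_of_cuts _ 'F_2).
  (* The potential of the indicator cochain of one edge changes across that edge and across no
     other. *)
  have cut g : exists2 phi : coset_vertex -> 'F_2, phi (va g) <> phi (vb g) &
      forall h, (va h = va g /\ vb h = vb g) \/ phi (va h) = phi (vb h).
    pose psi (e : bE X) : 'F_2 :=
      if excluded_middle_informative (e = beact g (bbase X)) then 1%R else 0%R.
    have psi1 : psi (beact g (bbase X)) = 1%R.
      by rewrite /psi; case: (excluded_middle_informative _).
    have psi0 e : e <> beact g (bbase X) -> psi e = 0%R.
      by rewrite /psi; case: (excluded_middle_informative _).
    have [phi phiP] := coset_coboundary psi.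
    exists (fun x => phi (proj1_sig x)) => [|h].
      change (phi (bvact g a0) <> phi (bvact g b0)) => e.
      by have := phiP g; rewrite psi1 e subrr => /eqP; rewrite oner_eq0.
    have [e | e] := classic (beact h (bbase X) = beact g (bbase X)); last first.
      right; change (phi (bvact h a0) = phi (bvact h b0)).
      by have := phiP h; rewrite psi0 // => /esym/eqP; rewrite subr_eq0 => /eqP.
    left; split; apply: sig_eq.
      by change (bvact h a0 = bvact g a0); rewrite /a0 -!bsrc_act e.
    by change (bvact h b0 = bvact g b0); rewrite /b0 -!btgt_act e.
  move=> x y [g xy]; have [phi nphi phiP] := cut g; exists phi.
    by case: xy => -[-> ->] //; apply/nesym.
  move=> a b [h ab]; have := phiP h.
  by case: xy => -[-> ->]; case: ab => -[-> ->]; intuition.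
pose R x y := exists l, is_walk coset_adj x l y.
have Rsym x y : R x y -> R y x by case=> l /(is_walk_rev sym).
have Rtr x y z : R x y -> R y z -> R x z.
  by move=> [l xl] [k yk]; exists (l ++ k); apply: is_walk_cat xl yk.
have Rab g : R (va g) (vb g) by exists [:: vb g]; split=> //; exists g; left.
have Ra g : R (va gone) (va g).
  move: g; apply: (coxeter_ind cox) => [|g w IH]; first by exists [::].
  (* For [w = u] the vertices [va g] and [va (g s_u)] are both adjacent to [vb g]. *)
  have [wu | wu] := classic (w = u); last by rewrite va_gen.
  apply: (Rtr _ _ _ IH); apply: (Rtr _ _ _ (Rab g)); apply: Rsym.
  by have := Rab (gmul g (s w)); rewrite vb_gen ?wu.
have Rx x : R (va gone) x.
  by have [g [-> | ->]] := coset_vertexP x; [| apply: (Rtr _ _ _ (Ra g) (Rab g))].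
by move=> x y; apply: (Rtr _ _ _ _ (Rx y)); apply: Rsym.
Qed.

Definition coset_act (h : W) (x : coset_vertex) : coset_vertex.
Proof.
exists (bvact h (proj1_sig x)); have [g [-> | ->]] := proj2_sig x; exists (gmul h g).
  by left; exact: esym (actM (@bvactP _ _ _ _ _ X) _ _ _).
by right; exact: esym (actM (@bvactP _ _ _ _ _ X) _ _ _).
Defined.

Lemma coset_act_va h g : coset_act h (va g) = va (gmul h g).
Proof. by apply: sig_eq; exact: esym (actM (@bvactP _ _ _ _ _ X) _ _ _). Qed.

Lemma coset_act_vb h g : coset_act h (vb g) = vb (gmul h g).
Proof. by apply: sig_eq; exact: esym (actM (@bvactP _ _ _ _ _ X) _ _ _). Qed.

Lemma coset_tree_action : TreeActionNoInv coset_adj coset_act.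
Proof.
split; first by move=> x; apply: sig_eq; exact: (act1 (@bvactP _ _ _ _ _ X)).
split; first by move=> g h x; apply: sig_eq; exact: (actM (@bvactP _ _ _ _ _ X)).
split.
  move=> h x y [g [[-> ->] | [-> ->]]]; exists (gmul h g);
  by rewrite coset_act_va coset_act_vb; auto.
move=> h x y [g [[-> ->] | [-> ->]]]; rewrite coset_act_va coset_act_vb => -[e e'].
  exact: va_vb e.
exact: va_vb e'.
Qed.

(** A fixed vertex would place [s u] in the subgroup generated by the other generators, or likewise
    [s v]; [coxeter_separation] excludes both. *)
Lemma not_FA_of_nonadjacent : ~ PropertyFA W.
Proof.
move=> /(_ _ _ _ coset_tree coset_tree_action) [x fixx].
have aX := @bvactP _ _ _ _ _ X.
have conj g (z : bV X) : proj1_sig x = bvact g z -> forall h : W, bvact h z = z.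
  move=> xz h; apply: (act_inj aX (g := g)); rewrite -(actM aX).
  have -> : gmul g h = gmul (gmul (gmul g h) (ginv g)) g by rewrite -gmulA gmulVx gmulx1.
  rewrite (actM aX) -xz.
  by change (proj1_sig (coset_act (gmul (gmul g h) (ginv g)) x) = proj1_sig x); rewrite fixx.
have out w : ~ special (fun w' => w' <> w) (s w).
  have [S [f [x0 [_ fP f0 fw]]]] := coxeter_separation w cox.
  by move/(special_fix fP f0).
case: (proj2_sig x) => g [/conj/(_ (s u)) | /conj/(_ (s v))].
  by move/src_stabilizer/out.
by move/tgt_stabilizer/out.
Qed.

End CosetTree.

(** * Conclusion: FA forces completeness and passes through the completion *)

Lemma FA_complete (Gam : CoxGraph) (W : Group) (s : cV Gam -> W) :
  IsCoxeterPresentation s -> PropertyFA W -> complete Gam.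
Proof.
move=> cox fa u v uv; apply: NNPP => nuv.
exact: (not_FA_of_nonadjacent cox uv nuv fa).
Qed.

Lemma FA_transfer (W W' : Group) : IsCoxeterGroup W -> IsCoxeterGroup W' ->
  ProfiniteCompletionsIsomorphic W W' -> PropertyFA W -> PropertyFA W'.
Proof.
move=> [Gam [s cox]] [Gam' [s' cox']] iso fa; apply: (complete_FA cox') => u v uv.
apply: NNPP => nuv; have [phi [phiM phi_compat phi_onto]] := profinite_maps iso.
exact: (no_complete_source cox' uv nuv phiM phi_compat phi_onto cox (FA_complete cox fa)).
Qed.

(** Only the multiplicativity of [F'] is not given: it follows by applying [F'] to that of [F] at
    [F' r] and [F' q]. *)
Lemma profinite_iso_sym (G H : Group) :
  ProfiniteCompletionsIsomorphic G H -> ProfiniteCompletionsIsomorphic H G.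
Proof.
move=> [F [F' [thF [thF' [eqF [eqF' [F'F [FF' [FM [cF cF']]]]]]]]]].
have tcong r1 r2 q1 q2 : teq r1 q1 -> teq r2 q2 -> teq (tmul r1 r2) (tmul q1 q2).
  move=> e1 e2 N; rewrite /tmul ginvM -gmulA.
  have := fN_mul (fN_normal (r2 N) (e1 N)) (e2 N).
  by rewrite -!gmulA gmulKV.
have tsym r q : teq r q -> teq q r.
  by move=> e N; have := fN_inv (e N); rewrite ginvM ginvK.
have ttr r1 r2 r3 : teq r1 r2 -> teq r2 r3 -> teq r1 r3.
  by move=> e1 e2 N; have := fN_mul (e1 N) (e2 N); rewrite -gmulA gmulKV.
have tmul_thread r q : thread r -> thread q -> thread (tmul r q).
  move=> tr tq N M NM; rewrite /tmul ginvM -gmulA.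
  have := fN_mul (fN_normal (q N) (tr N M NM)) (tq N M NM).
  by rewrite -!gmulA gmulKV.
exists F', F; do 6![split=> //]; split=> // r q tr tq.
have [tr' tq'] := (thF' _ tr, thF' _ tq).
have tM := tmul_thread _ _ _ tr' tq'.
apply: (ttr _ _ _ _ _ (F'F _ tM)); apply: eqF'; [exact: tmul_thread | exact: thF |].
apply: tsym; apply: (ttr _ _ _ _ (FM _ _ tr' tq')); apply: tcong; exact: FF'.
Qed.

Theorem theorem6p5 (W W' : Group) :
  IsCoxeterGroup W -> IsCoxeterGroup W' ->
  ProfiniteCompletionsIsomorphic W W' ->
  (PropertyFA W <-> PropertyFA W').
Proof.
move=> coxW coxW' iso; split; first exact: FA_transfer.
exact/FA_transfer/profinite_iso_sym.
Qed.
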